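(* Let $\mathbb{K}$ be a commutative ring. For any simplicial complex $S$ there is an isomorphism $$H_*(S)\cong H^{\mathsf{sc}}_*(G(S))$$ between the simplicial homology of $S$ with coefficients in $\mathbb{K}$ and the square-commutative homology over $\mathbb{K}$ of the associated digraph $G(S)$.
   Context: The digraph $G(S)$: its vertices are the (nonempty) simplices of $S$, and there is a non-degenerate edge $\sigma\to\tau$ if and only if $\tau\subseteq\sigma$ and $\dim(\sigma)=\dim(\tau)+1$; in addition every vertex carries a degenerate edge $(\sigma,\sigma)$. (By a digraph $G=(V,E)$ one means a set $V$ with $E\subseteq V^2$ containing all $(v,v)$; the edge $(v,u)$ goes from $v$ to $u$.) Square-commutative homology of a digraph $G=(V,E)$. $\mathcal{Z}(G)$ is the category with object set $V$ and $\mathcal{Z}(G)(v,u)=\{(v,u)\}\sqcup\{z_{v,u}\}$ if $(v,u)\in E$, and $\{z_{v,u}\}$ otherwise, where $z_{v,u}$ is a new formal arrow; $(v,v)$ is the identity of $v$ and the composite of any two non-identity morphisms $v\to v'\to v''$ is $z_{v,v''}$. Then $\Omega^{\mathsf{sc}}G=\Omega(\mathcal{Z}(G),E)$ and $H^{\mathsf{sc}}_*(G)=H_*(\Omega^{\mathsf{sc}}G)$. Here, for a small category $\mathcal{C}$ and a set $M$ of morphisms containing all identities, $\mathsf{N}\mathcal{C}$ is the normalized chain complex over $\mathbb{K}$ of the nerve of $\mathcal{C}$: $(\mathsf{N}\mathcal{C})_0$ is free on objects; $(\mathsf{N}\mathcal{C})_n$ is free on symbols $\langle\gamma_1,\dots,\gamma_n\rangle$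 of composable non-identity morphisms ($\mathrm{codom}(\gamma_i)=\mathrm{dom}(\gamma_{i+1})$), a symbol with an identity entry being $0$; $\partial=\sum_{i=0}^n(-1)^i\tilde d_i$, where $\tilde d_0$ deletes $\gamma_1$, $\tilde d_n$ deletes $\gamma_n$, $\tilde d_i$ ($1\le i\le n-1$) replaces $\gamma_i,\gamma_{i+1}$ by $\gamma_{i+1}\gamma_i$, and for $n=1$ $\tilde d_0\langle\gamma\rangle=\mathrm{codom}(\gamma)$, $\tilde d_1\langle\gamma\rangle=\mathrm{dom}(\gamma)$. $(\mathsf{N}M)_0=(\mathsf{N}\mathcal{C})_0$ and $(\mathsf{N}M)_n$ is spanned by the symbols with all $\gamma_i\in M$. $\Omega(\mathcal{C},M)$ is the subcomplex of $\mathsf{N}\mathcal{C}$ with $\Omega_n(\mathcal{C},M)=(\mathsf{N}M)_n\cap\partial^{-1}((\mathsf{N}M)_{n-1})$. *)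

(* Defs.v *)
From HB Require Import structures.
From mathcomp Require Import all_boot all_order all_algebra finmap.
From mathcomp Require Import boolp classical_sets functions cardinality fsbigop.
From mathcomp Require Import wochoice.

Set Implicit Arguments.
Unset Strict Implicit.
Unset Printing Implicit Defensive.

Import GRing.Theory.
Local Open Scope ring_scope.
Local Open Scope classical_set_scope.

Section Submodule.
Variables (K : pzRingType) (M : lmodType K) (P : submodClosed M).

Record submod := Submod { submod_val : M; submod_valP : submod_val \in P }.

HB.instance Definition _ := [isSub for submod_val].
HB.instance Definition _ := [Choice of submod by <:].
HB.instance Definition _ := [SubChoice_isSubLmodule of submod by <:].

End Submodule.

Section QuotientModule.
Variables (K : pzRingType) (M : lmodType K) (P : submodClosed M).

Definition quotmod_rel : {pred M} := fun x => x \in P.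

Fact quotmod_zmod_closed : zmod_closed quotmod_rel.
Proof.
split=> [|x y]; first exact: (rpred0 P).
move=> xP yP; have {}xP : x \in P by []; have {}yP : y \in P by [].
by rewrite -[_ \in _]/(_ \in P) rpredD // -scaleN1r rpredZ.
Qed.

HB.instance Definition _ :=
  GRing.isZmodClosed.Build M quotmod_rel quotmod_zmod_closed.

Definition quotmod := Quotient.quot quotmod_rel.

HB.instance Definition _ := GRing.Zmodule.on quotmod.

Local Open Scope quotient_scope.

Definition quotmod_pi (x : M) : quotmod := \pi_(Quotient.quot quotmod_rel) x.

Lemma quotmod_pi_eq x y : (quotmod_pi x = quotmod_pi y) <-> (x - y \in P).
Proof.
by rewrite -[_ \in P]/(_ \in quotmod_rel) Quotient.idealrBE; split=> [h|/eqP]; [apply/eqP | move=> h].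
Qed.

Lemma quotmod_pi_surj (q : quotmod) : {x | q = quotmod_pi x}.
Proof. by exists (repr q); rewrite /quotmod_pi reprK. Qed.

Lemma quotmod_piD : {morph quotmod_pi : x y / x + y}.
Proof. by move=> x y; rewrite /quotmod_pi Quotient.pi_add. Qed.

Definition quotmod_scale (a : K) (q : quotmod) : quotmod :=
  quotmod_pi (a *: repr (q : Quotient.quot quotmod_rel)).

Lemma quotmod_scaleE a x : quotmod_scale a (quotmod_pi x) = quotmod_pi (a *: x).
Proof.
apply/quotmod_pi_eq; rewrite -scalerBr rpredZ //.
by apply/quotmod_pi_eq; rewrite /quotmod_pi reprK.
Qed.

Fact quotmod_scalerA a b q :
  quotmod_scale a (quotmod_scale b q) = quotmod_scale (a * b) q.
Proof. by case: (quotmod_pi_surj q) => x ->; rewrite !quotmod_scaleE scalerA. Qed.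

Fact quotmod_scale1r : left_id 1 quotmod_scale.
Proof.
by move=> q; case: (quotmod_pi_surj q) => x ->; rewrite quotmod_scaleE scale1r.
Qed.

Fact quotmod_scalerDr : right_distributive quotmod_scale +%R.
Proof.
move=> a q r; case: (quotmod_pi_surj q) => x ->; case: (quotmod_pi_surj r) => y ->.
by rewrite -quotmod_piD !quotmod_scaleE -quotmod_piD scalerDr.
Qed.

Fact quotmod_scalerDl q : {morph quotmod_scale^~ q : a b / a + b}.
Proof.
move=> a b; case: (quotmod_pi_surj q) => x ->.
by rewrite !quotmod_scaleE -quotmod_piD scalerDl.
Qed.

HB.instance Definition _ := GRing.Zmodule_isLmodule.Build K quotmod
  quotmod_scalerA quotmod_scale1r quotmod_scalerDr quotmod_scalerDl.

Fact quotmod_pi_linear : linear quotmod_pi.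
Proof. by move=> a x y; rewrite quotmod_piD -quotmod_scaleE. Qed.

HB.instance Definition _ :=
  GRing.isLinear.Build K M quotmod *:%R quotmod_pi quotmod_pi_linear.

End QuotientModule.

(* [K]-linear chain complexes concentrated in degrees [n >= 0];
   [bnd n] is the differential from degree [n.+1] to degree [n]. *)
Record complex (K : pzRingType) := Complex {
  chains :> nat -> lmodType K;
  bnd : forall n, {linear chains n.+1 -> chains n};
  bndK : forall n (x : chains n.+2), bnd n (bnd n.+1 x) = 0
}.

Section Homology.
Variables (K : pzRingType) (C : complex K) (n : nat).

Definition is_cycle : {pred C n} :=
  match n return {pred C n} with
  | 0 => predT
  | m.+1 => fun x => bnd C m x == 0
  end.

Fact cycle_submod_closed : submod_closed is_cycle.
Proof.
rewrite /is_cycle; case: n => [|m]; first by split.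
split; rewrite ?unfold_in ?linear0 // => a x y.
by rewrite !unfold_in linearP => /eqP-> /eqP->; rewrite scaler0 addr0.
Qed.

HB.instance Definition _ :=
  GRing.isSubmodClosed.Build K (C n) is_cycle cycle_submod_closed.

Definition is_boundary : {pred submod is_cycle} :=
  fun z => `[< exists y : C n.+1, bnd C n y = val z >].

Fact boundary_submod_closed : submod_closed is_boundary.
Proof.
split; first by apply/asboolP; exists 0; rewrite linear0.
move=> a u v /asboolP[x xu] /asboolP[y yv]; apply/asboolP.
by exists (a *: x + y); rewrite linearP /= xu yv.
Qed.

HB.instance Definition _ :=
  GRing.isSubmodClosed.Build K (submod is_cycle) is_boundary boundary_submod_closed.

Definition homology : lmodType K := quotmod is_boundary.

End Homology.

Section Subcomplex.
Variables (K : pzRingType) (C : complex K).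
Variable P : forall n, submodClosed (C n).
Hypothesis bndP : forall n (x : C n.+1), x \in P n.+1 -> bnd C n x \in P n.

Definition sub_bnd n (x : submod (P n.+1)) : submod (P n) :=
  Submod (bndP (valP x)).

Fact sub_bnd_linear n : linear (@sub_bnd n).
Proof. by move=> a x y; apply: val_inj; rewrite /= !linearP. Qed.

HB.instance Definition _ n := GRing.isLinear.Build K
  (submod (P n.+1)) (submod (P n)) *:%R (@sub_bnd n) (@sub_bnd_linear n).

Fact sub_bndK n (x : submod (P n.+2)) : sub_bnd (sub_bnd x) = 0.
Proof. by apply: val_inj; rewrite /= bndK. Qed.

Definition subcomplex : complex K :=
  @Complex K (fun n => submod (P n)) (fun n => @sub_bnd n) sub_bndK.

End Subcomplex.

(* The free module on [T]: finitely supported functions [T -> K]. *)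
Section FreeModule.
Variables (K : pzRingType) (T : choiceType).

Definition fin_supp : {pred T -> K^o} :=
  fun x => `[< finite_set [set t | x t != 0] >].

Fact finsupp_submod_closed : submod_closed fin_supp.
Proof.
split.
  apply/asboolP; rewrite (_ : [set _ | _] = set0) //.
  by apply/seteqP; split=> // t /=; rewrite eqxx.
move=> a x y /asboolP fx /asboolP fy; apply/asboolP.
have fxy : finite_set ([set t | x t != 0] `|` [set t | y t != 0]).
  by rewrite finite_setU.
apply: sub_finite_set fxy => t /= h; apply/orP; move: h; apply: contraNT.
rewrite negb_or !negbK => /andP[/eqP xt /eqP yt].
by rewrite !fctE xt yt scaler0 addr0.
Qed.

HB.instance Definition _ :=
  GRing.isSubmodClosed.Build K (T -> K^o) fin_supp finsupp_submod_closed.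

Definition freemod : lmodType K := submod fin_supp.

Definition coef (x : freemod) (t : T) : K := submod_val x t.
Arguments coef : simpl never.

Lemma coefP x y : coef x =1 coef y -> x = y.
Proof. by move=> h; apply/val_inj/funext. Qed.

Lemma finite_coef x : finite_set [set t | coef x t != 0].
Proof. by rewrite /coef; case: x => x /= /asboolP. Qed.

Lemma coef_linear a x y t : coef (a *: x + y) t = a * coef x t + coef y t.
Proof. by []. Qed.

Fact basis_subproof t : (fun u => (u == t)%:R : K^o) \in fin_supp.
Proof.
apply/asboolP; apply: sub_finite_set (finite_set1 t) => u /=.
by case: (u =P t) => //; rewrite eqxx.
Qed.

Definition basis (t : T) : freemod := Submod (basis_subproof t).

Lemma coef_basis t u : coef (basis t) u = (u == t)%:R.
Proof. by []. Qed.

Variables (M : lmodType K) (f : T -> M).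

Definition flift (x : freemod) : M := \sum_(t \in [set: T]) coef x t *: f t.

Lemma liftE (A : {fset T}) (x : freemod) :
  (forall t, t \notin A -> coef x t = 0) ->
  flift x = \sum_(t <- A) coef x t *: f t.
Proof.
by move=> xA; rewrite /flift (fsbigTE A) // => t /xA->; rewrite scale0r.
Qed.

Fact lift_linear : linear flift.
Proof.
move=> a x y.
have [A xA] := finite_fsetP.1 (finite_coef x).
have [B yB] := finite_fsetP.1 (finite_coef y).
have x0 t : t \notin (A `|` B)%fset -> coef x t = 0.
  rewrite inE negb_or => /andP[tA _]; apply/eqP; apply: contraNT tA => xt.
  by have : [set` A] t by rewrite -xA.
have y0 t : t \notin (A `|` B)%fset -> coef y t = 0.
  rewrite inE negb_or => /andP[_ tB]; apply/eqP; apply: contraNT tB => yt.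
  by have : [set` B] t by rewrite -yB.
rewrite (liftE x0) (liftE y0) (@liftE (A `|` B)%fset) => [|t tAB].
  rewrite scaler_sumr -big_split /=; apply: eq_bigr => t _.
  by rewrite -[coef (_ + _) t]/(a * coef x t + coef y t) scalerDl scalerA.
by rewrite -[LHS]/(a * coef x t + coef y t) (x0 _ tAB) (y0 _ tAB) mulr0 addr0.
Qed.

HB.instance Definition _ :=
  GRing.isLinear.Build K freemod M *:%R flift lift_linear.

Lemma lift_basis t : flift (basis t) = f t.
Proof.
rewrite (@liftE [fset t]%fset) => [|u].
  by rewrite big_seq_fset1 coef_basis eqxx scale1r.
by rewrite inE coef_basis => /negPf->.
Qed.

End FreeModule.

Lemma freemod_ind (K : pzRingType) (T : choiceType) (P : freemod K T -> Prop) :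
    P 0 -> (forall a t x, P x -> P (a *: basis K t + x)) -> forall x, P x.
Proof.
move=> P0 PD x; have [A xA] := finite_fsetP.1 (finite_coef x).
have {xA} x0 t : t \notin A -> coef x t = 0.
  move=> tA; apply/eqP; apply: contraNT tA => xt.
  by have : [set` A] t by rewrite -xA.
have {x0} -> : x = \sum_(t <- A) coef x t *: basis K t.
  apply: coefP => u; pose c (y : freemod K T) : K^o := coef y u.
  have cD : {morph c : y z / y + z} by [].
  rewrite -[RHS]/(c _) (big_morph c cD (erefl : c 0 = 0)).
  have cE t : c (coef x t *: basis K t) = coef x t * (u == t)%:R by [].
  under eq_bigr do rewrite cE; move: (coef x) x0 => g g0 {c cD cE}.
  have [uA|uA] := boolP (u \in A); last first.
    rewrite g0 // big_seq big1 // => t tA.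
    by case: (u =P t) tA uA => [->->|]; rewrite ?mulr0.
  rewrite (big_fsetD1 u) //= eqxx mulr1 big_seq big1 ?addr0 // => t.
  by rewrite !inE eq_sym => /andP[/negPf-> _]; rewrite mulr0.
by elim/big_rec: _ => // t y _ Py; apply: PD.
Qed.

Lemma alternating_sum0 (K : pzRingType) (M : lmodType K) m
    (F : nat -> nat -> M) :
    (forall i j, (i <= j < m)%N -> F i j.+1 = F j i) ->
  \sum_(j < m.+1) (-1) ^+ j *: (\sum_(i < m) (-1) ^+ i *: F i j) = 0.
Proof.
elim: m => [|m IHm] FE; first by rewrite big_ord1 big_ord0 scaler0.
rewrite big_ord_recr /=; under eq_bigr do rewrite big_ord_recr /= scalerDr.
rewrite big_split /= IHm ?add0r => [|i j /andP[ij jm]]; last first.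
  by rewrite FE // ij ltnS ltnW.
rewrite scaler_sumr -big_split big1 //= => i _.
rewrite FE ?leq_ord ?ltnSn // !scalerA -!exprD addSn [in X in _ + X]exprS.
by rewrite mulN1r scaleNr addnC subrr.
Qed.

(* A small category, presented by its sets of objects and of morphisms;
   [mcomp g f] is the composite of [f] followed by [g] and is meaningful only
   when [cod f = dom g]. *)
Record category := Category {
  obj : choiceType;
  mor : choiceType;
  dom : mor -> obj;
  cod : mor -> obj;
  idm : obj -> mor;
  mcomp : mor -> mor -> mor;
  dom_id : forall x, dom (idm x) = x;
  cod_id : forall x, cod (idm x) = x;
  dom_comp : forall g f, cod f = dom g -> dom (mcomp g f) = dom f;
  cod_comp : forall g f, cod f = dom g -> cod (mcomp g f) = cod g;
  comp_idl : forall f, mcomp (idm (cod f)) f = f;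
  comp_idr : forall f, mcomp f (idm (dom f)) = f;
  compA : forall h g f, cod f = dom g -> cod g = dom h ->
    mcomp h (mcomp g f) = mcomp (mcomp h g) f
}.

Section Nerve.
Variables (K : pzRingType) (C : category).
Implicit Types (x : obj C) (g h : mor C) (s : seq (mor C)).

Definition isid g := g == idm (dom g).

Fixpoint composable x s : bool :=
  if s is g :: s' then (dom g == x) && composable (cod g) s' else true.

(* A generator of degree [n]: a source object [x] followed by [n] composable
   non-identity morphisms.  The source is determined by the morphisms as soon
   as [n > 0], and for [n = 0] the generators are the objects. *)
Definition is_symbol n (p : obj C * seq (mor C)) : bool :=
  [&& size p.2 == n, composable p.1 p.2 & ~~ has isid p.2].

Record symbol n := Symbol {
  symbol_val : obj C * seq (mor C);
  symbolP : is_symbol n symbol_val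
}.

HB.instance Definition _ n := [isSub for @symbol_val n].
HB.instance Definition _ n := [Choice of symbol n by <:].

(* Composes the entries number [i] and [i.+1] (counting from 0), or deletes
   the last entry when [i] is its position. *)
Fixpoint merge_at i s {struct s} : seq (mor C) :=
  match s with
  | g :: ((h :: s'') as s') => if i is j.+1 then g :: merge_at j s' else mcomp h g :: s''
  | _ => [::]
  end.

Definition face i (p : obj C * seq (mor C)) : obj C * seq (mor C) :=
  match i, p.2 with
  | 0, g :: s => (cod g, s)
  | 0, [::] => p
  | j.+1, s => (p.1, merge_at j s)
  end.

Definition sym_elt n p : freemod K (symbol n) :=
  if insub p is Some t then basis K t else 0.

Definition nerve_bnd_gen n (p : obj C * seq (mor C)) : freemod K (symbol n) :=
  \sum_(i < n.+2) (-1) ^+ i *: sym_elt n (face i p).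

Definition nerve_bnd n : {linear freemod K (symbol n.+1) -> freemod K (symbol n)} :=
  flift (fun t : symbol n.+1 => nerve_bnd_gen n (val t)).

Lemma size_merge i s : (i < size s)%N -> size (merge_at i s) = (size s).-1.
Proof.
elim: s i => [|g [|h s] IHs] [|i] //=; rewrite ltnS => /IHs.
by move=> /= ->.
Qed.

Lemma composable_merge i x s : composable x s -> composable x (merge_at i s).
Proof.
elim: s i x => [|g [|h s] IHs] //= i x /and3P[/eqP<- /eqP hg hs].
case: i => [|i] /=; first by rewrite dom_comp ?cod_comp // eqxx.
by rewrite eqxx /= IHs //= hg eqxx.
Qed.

Lemma size_face i p : (i <= size p.2)%N -> (0 < size p.2)%N ->
  size (face i p).2 = (size p.2).-1.
Proof. by case: p i => x s [|i] => [|lt_is _]; [case: s | rewrite size_merge]. Qed.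

Lemma composable_face i p :
  composable p.1 p.2 -> composable (face i p).1 (face i p).2.
Proof.
case: p i => x s [|i] /=; last exact: composable_merge.
by case: s => [|g s] //= /andP[].
Qed.

Lemma merge_merge i j x s : composable x s -> (i <= j)%N ->
  merge_at i (merge_at j.+1 s) = merge_at j (merge_at i s).
Proof.
have mE n g h t : merge_at n.+1 [:: g, h & t] = g :: merge_at n (h :: t) by [].
elim: i j x s => [|i IHi] j x [|g [|h [|k s]]] //.
  case: j => [|j] /=; last by [].
  by case/and4P=> _ /eqP hg /eqP kh _ _; rewrite compA.
case: j => // j cs ij; rewrite !mE.
have cs' : composable (cod g) [:: h, k & s] by case/andP: cs.
have {IHi} := IHi j _ _ cs' ij; rewrite mE.
have [l [a ->]] : exists l a, merge_at i [:: h, k & s] = a :: l.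
  by case: i {ij} => [|i]; rewrite ?mE; do 2 eexists.
by move=> E; rewrite mE -E.
Qed.

Lemma face_face i j p : composable p.1 p.2 -> (i <= j)%N ->
  (1 < size p.2)%N -> face i (face j.+1 p) = face j (face i p).
Proof.
case: p => x s /= cs; case: i j => [|i] [|j] //; last first.
  by move=> ij _; congr (_, _); exact: (merge_merge cs).
- by case: s cs => [|g [|h s]].
case: s cs => [|g [|h s]] //= /and3P[_ /eqP hg _] _ _.
by rewrite /face /= cod_comp.
Qed.

Lemma merge_id_l x s1 e s2 : isid e -> composable x (s1 ++ e :: s2) ->
  merge_at (size s1) (s1 ++ e :: s2) = s1 ++ s2.
Proof.
move=> /eqP ide; elim: s1 x => [|g s1 IHs] x /=.
  case: s2 => [|h s2] //= /and3P[_ /eqP he _].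
  suff -> : e = idm (dom h) by rewrite comp_idr.
  by rewrite he ide cod_id.
by case/andP=> _ /IHs <-; case: s1 {IHs}.
Qed.

Lemma merge_id_r x g s1 e s2 : isid e -> composable x (g :: s1 ++ e :: s2) ->
  merge_at (size s1) (g :: s1 ++ e :: s2) = g :: s1 ++ s2.
Proof.
move=> /eqP ide; elim: s1 x g => [|h s1 IHs] x g /=.
  by case/and3P=> _ /eqP eg _; rewrite ide eg comp_idl.
by case/andP=> _ /IHs <-; case: s1 {IHs}.
Qed.

Lemma merge_id i s1 e s2 : (i < size (s1 ++ e :: s2))%N ->
  i != size s1 -> i.+1 != size s1 -> e \in merge_at i (s1 ++ e :: s2).
Proof.
elim: s1 i => [|g s1 IHs] i /=.
  by case: i s2 => [|i] [|h s2] //=; rewrite inE eqxx.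
case: i => [|i]; rewrite ltnS !eqSS; last first.
  by move=> /IHs h /h{h} h /h; case: s1 {IHs h} => [|k s1] /=;
    rewrite [in X in _ -> X]inE => ->; rewrite orbT.
by case: s1 {IHs} => //= h s1 _ _ _; rewrite !inE mem_cat mem_head !orbT.
Qed.

Local Arguments face : simpl never.

Lemma sym_degenerate n p : has isid p.2 -> sym_elt n p = 0.
Proof. by move=> h; rewrite /sym_elt insubN // /is_symbol h !andbF. Qed.

Lemma nerve_bnd_gen_degenerate n p : size p.2 = n.+1 ->
  composable p.1 p.2 -> has isid p.2 -> nerve_bnd_gen n p = 0.
Proof.
case: p => x s /= sz cs /hasP[e /splitPr es ide].
case: s / es sz cs => s1 s2; rewrite size_cat /= addnS => -[sz] cs.
have k1 : (size s1 < n.+2)%N by rewrite -sz ltnS leqW // leq_addr.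
have k2 : ((size s1).+1 < n.+2)%N by rewrite -sz !ltnS leq_addr.
have fl : face (size s1).+1 (x, s1 ++ e :: s2) = (x, s1 ++ s2).
  by rewrite /face /= (merge_id_l ide cs).
have fr : face (size s1) (x, s1 ++ e :: s2) = (x, s1 ++ s2).
  case: s1 cs {sz k1 k2 fl} => [|g s1] /= cs.
    by case/andP: cs => /eqP<- _; rewrite /face /= {1}(eqP ide) cod_id.
  by congr (_, _); apply: (merge_id_r ide cs).
rewrite /nerve_bnd_gen (bigD1 (Ordinal k1)) //= (bigD1 (Ordinal k2)) /=; last first.
  by rewrite -val_eqE /= gtn_eqF.
rewrite fl fr big1 => [|i /andP[i1 i2]].
  by rewrite addr0 exprS mulN1r scaleNr subrr.
rewrite sym_degenerate ?scaler0 //; apply/hasP; exists e => //.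
have {}i1 : val i != size s1 by [].
have {}i2 : val i != (size s1).+1 by [].
case: i i1 i2 => -[|i] lin i1 i2; rewrite /face /=.
  case: s1 i1 {i2 fl fr k1 k2 sz cs} => //= g s1 _.
  by rewrite mem_cat mem_head orbT.
apply: merge_id => //; first by rewrite size_cat /= addnS sz.
Qed.

Lemma nerve_bnd_sym n p : size p.2 = n.+1 -> composable p.1 p.2 ->
  nerve_bnd n (sym_elt n.+1 p) = nerve_bnd_gen n p.
Proof.
move=> sz cp; have [hp|hp] := boolP (has isid p.2).
  by rewrite sym_degenerate // linear0 nerve_bnd_gen_degenerate.
have sp : is_symbol n.+1 p by rewrite /is_symbol sz eqxx cp.
by rewrite /sym_elt insubT /nerve_bnd /= lift_basis.
Qed.

Lemma nerve_bndK n (c : freemod K (symbol n.+2)) :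
  nerve_bnd n (nerve_bnd n.+1 c) = 0.
Proof.
elim/freemod_ind: c => [|a [p pP] c IHc]; first by rewrite !linear0.
rewrite !linearP IHc addr0 {1}/nerve_bnd /= lift_basis /=.
have /and3P[/eqP sz cp _] := pP.
rewrite [nerve_bnd_gen _ _]/nerve_bnd_gen linear_sum /=.
under eq_bigr => i _.
  rewrite linearZ /= nerve_bnd_sym; first over.
    by rewrite size_face sz // -ltnS.
  exact: composable_face.
rewrite (@alternating_sum0 _ _ _ (fun i j => sym_elt n (face i (face j p)))).
  by rewrite scaler0.
by move=> i j /andP[ij _]; rewrite face_face // sz.
Qed.

Definition nerve : complex K := Complex nerve_bndK.

End Nerve.

Section Omega.
Variables (K : pzRingType) (C : category) (M : set (mor C)).

(* [allowed n] is the span of the symbols all of whose entries lie in [M]. *)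
Definition allowed n : {pred nerve K C n} :=
  fun c => `[< forall t, coef c t != 0 ->
               forall g, g \in (symbol_val t).2 -> M g >].

Fact allowed_submod_closed n : submod_closed (@allowed n).
Proof.
split; first by apply/asboolP => t; rewrite /coef /= eqxx.
move=> a c d /asboolP cM /asboolP dM; apply/asboolP => t.
rewrite -[coef _ t]/(a * coef c t + coef d t) => cdt.
have [c0|/cM//] := eqVneq (coef c t) 0.
by apply: dM; move: cdt; rewrite c0 mulr0 add0r.
Qed.

HB.instance Definition _ n := GRing.isSubmodClosed.Build K (nerve K C n)
  (@allowed n) (allowed_submod_closed n).

Definition omega_pred n : {pred nerve K C n} :=
  match n return {pred nerve K C n} with
  | 0 => @allowed 0
  | m.+1 => fun c => (c \in @allowed m.+1) && (bnd (nerve K C) m c \in @allowed m)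
  end.

Fact omega_submod_closed n : submod_closed (@omega_pred n).
Proof.
case: n => [|n]; first exact: allowed_submod_closed.
split; first by rewrite -[_ \in _]/(_ && _) linear0 !rpred0.
move=> a c d; rewrite -![_ \in @omega_pred _]/(_ && _).
move=> /andP[cM bcM] /andP[dM bdM].
by rewrite linearP !(rpredD, rpredZ).
Qed.

HB.instance Definition _ n := GRing.isSubmodClosed.Build K (nerve K C n)
  (@omega_pred n) (omega_submod_closed n).

Fact omega_bnd n (c : nerve K C n.+1) :
  c \in @omega_pred n.+1 -> bnd (nerve K C) n c \in @omega_pred n.
Proof.
case: n c => [|n] c /andP[_ bcM] //.
by rewrite -[_ \in _]/(_ && _) bcM bndK rpred0.
Qed.

Definition omega : complex K := subcomplex omega_bnd.

End Omega.

(* The edge [(v, u)] goes from [v] to [u]. *)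
Record digraph := Digraph {
  vtx : choiceType;
  edge : set (vtx * vtx);
  edge_refl : forall v, edge (v, v)
}.

Arguments edge : clear implicits.

Section SquareCommutative.
Variable G : digraph.

(* [inl e] is the edge [e], [inr (v, u)] is the formal arrow z_{v,u}. *)
Definition zmor : choiceType := (edge G + vtx G * vtx G)%type.

Definition zends (f : zmor) : vtx G * vtx G :=
  match f with inl e => val e | inr z => z end.

Definition zdom f := (zends f).1.
Definition zcod f := (zends f).2.

Definition zid (v : vtx G) : zmor := inl (exist _ (v, v) (mem_set (edge_refl v))).

Definition zcomp (g f : zmor) : zmor :=
  if f == zid (zdom f) then g
  else if g == zid (zdom g) then f
  else inr (zdom f, zcod g).

Fact zdom_id v : zdom (zid v) = v. Proof. by []. Qed.
Fact zcod_id v : zcod (zid v) = v. Proof. by []. Qed.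

Fact zdom_comp g f : zcod f = zdom g -> zdom (zcomp g f) = zdom f.
Proof.
by rewrite /zcomp; case: eqP => [-> <-|_ _] //; case: eqP.
Qed.

Fact zcod_comp g f : zcod f = zdom g -> zcod (zcomp g f) = zcod g.
Proof.
by rewrite /zcomp; case: eqP => // _; case: eqP => [-> ->|].
Qed.

Fact zcomp_idl f : zcomp (zid (zcod f)) f = f.
Proof. by rewrite /zcomp eqxx; case: eqP => // ->. Qed.

Fact zcomp_idr f : zcomp f (zid (zdom f)) = f.
Proof. by rewrite /zcomp eqxx. Qed.

Fact zcompA h g f : zcod f = zdom g -> zcod g = zdom h ->
  zcomp h (zcomp g f) = zcomp (zcomp h g) f.
Proof.
move=> fg gh; rewrite /zcomp.
case: (f =P zid _) => // fN; case: (g =P zid _) => gN.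
  by move/eqP: fN => /negPf->.
case: (h =P zid _) => hN /=; last by [].
by move/eqP: gN => /negPf->.
Qed.

Definition zcat : category := Category zdom_id zcod_id zdom_comp zcod_comp
  zcomp_idl zcomp_idr zcompA.

Definition zedges : set (mor zcat) := [set f | exists e, f = inl e].

Variable K : pzRingType.

Definition omega_sc : complex K := omega K zedges.

Definition homology_sc (n : nat) : lmodType K := homology omega_sc n.

End SquareCommutative.

Section Simplicial.
Variable V : choiceType.

Record simplicial_complex := SimplicialComplex {
  simplex :> set {fset V};
  simplex_neq0 : forall s, simplex s -> s != fset0;
  simplex_sub : forall s t, simplex s -> (t `<=` s)%fset -> t != fset0 -> simplex t
}.

Definition sdim (s : {fset V}) : nat := #|` s|.-1.

Section SimplexDigraph.
Variable S : simplicial_complex.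

(* The vertices of the digraph are the elements of the subtype [{s | s \in S}]. *)
Definition face_edge : set (S * S) :=
  [set e | e.1 = e.2 \/
           (val e.2 `<=` val e.1)%fset /\ sdim (val e.1) = (sdim (val e.2)).+1].

Fact face_edge_refl s : face_edge (s, s). Proof. by left. Qed.

Definition simplex_digraph : digraph := Digraph face_edge_refl.

End SimplexDigraph.

(* A total order on the vertices, which fixes the signs in the simplicial chain
   complex and enters nowhere else; one exists on every set. *)
Record vertex_order := VertexOrder {
  vle :> rel V;
  vle_anti : antisymmetric vle;
  vle_trans : transitive vle;
  vle_total : total vle
}.

Lemma vertex_order_exists : inhabited vertex_order.
Proof.
have [R Rwo] := well_ordering_principle V.
have Rtot : total R.
  move=> x y; have [|m [[mxy lb] _]] := Rwo (mem [:: x; y]).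
    by exists x; apply: mem_head.
  move: mxy; rewrite !inE => /orP[] /eqP mE; move: lb; rewrite mE => lb.
    by apply/orP; left; apply: lb; rewrite !inE eqxx orbT.
  by apply/orP; right; apply: lb; rewrite !inE eqxx.
have Ranti : antisymmetric R.
  move=> x y /andP[xy yx]; have [|m [_ uniq_m]] := Rwo (mem [:: x; y]).
    by exists x; apply: mem_head.
  have Rxx z : R z z by have := Rtot z z; rewrite orbb.
  rewrite -(uniq_m x); first apply: uniq_m; split; rewrite ?inE ?eqxx ?orbT //.
    by move=> z; rewrite !inE => /orP[] /eqP->.
  by move=> z; rewrite !inE => /orP[] /eqP->.
suff Rtrans : transitive R by split; exists R.
move=> y x z xy yz; have [|m [[mxyz lb] _]] := Rwo (mem [:: x; y; z]).
  by exists x; apply: mem_head.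
have mx : R m x by apply: lb; rewrite !inE eqxx.
have my : R m y by apply: lb; rewrite !inE eqxx orbT.
have mz : R m z by apply: lb; rewrite !inE eqxx !orbT.
move: mxyz; rewrite !inE => /or3P[] /eqP mE; rewrite mE in mx my mz => //.
  by rewrite (Ranti x y) // xy mx.
by rewrite (Ranti z y) // my yz.
Qed.

Section SimplicialChains.
Variables (K : pzRingType) (S : simplicial_complex) (o : vertex_order).

Definition is_simplex n (s : {fset V}) : bool :=
  (s \in (S : set {fset V})) && (sdim s == n).

Record simplex_of n := SimplexOf {
  simplex_val : {fset V};
  simplex_ofP : is_simplex n simplex_val
}.

HB.instance Definition _ n := [isSub for @simplex_val n].
HB.instance Definition _ n := [Choice of simplex_of n by <:].

Definition simp_elt n (s : {fset V}) : freemod K (simplex_of n) :=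
  if insub s is Some t then basis K t else 0.

(* The position of [v] in the increasing enumeration of [s], from 0. *)
Definition vpos (v : V) (s : {fset V}) : nat :=
  count (fun u => o u v && (u != v)) s.

Definition simplicial_bnd_gen n (s : {fset V}) : freemod K (simplex_of n) :=
  \sum_(v <- s) (-1) ^+ vpos v s *: simp_elt n (s `\ v)%fset.

Definition simplicial_bnd n :
    {linear freemod K (simplex_of n.+1) -> freemod K (simplex_of n)} :=
  flift (fun t : simplex_of n.+1 => simplicial_bnd_gen n (simplex_val t)).

Lemma pos_rem v w s : v \in s ->
  vpos w s = ((o v w && (v != w)) + vpos w (s `\ v)%fset)%N.
Proof.
move=> vs; rewrite /vpos -[RHS]/(count _ (v :: (s `\ v)%fset)).
apply/permP/uniq_perm; rewrite /= ?fset_uniq ?andbT ?inE ?eqxx // => u.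
by rewrite !inE; case: (u =P v) => // ->.
Qed.

Lemma is_simplex_rem n s v : is_simplex n.+1 s -> v \in s ->
  is_simplex n (s `\ v)%fset.
Proof.
case/andP=> /set_mem sS /eqP; rewrite /is_simplex /sdim => ds vs.
move: ds; rewrite (cardfsD1 v) vs add1n /= => ds; rewrite ds eqxx andbT.
apply/mem_set/(simplex_sub sS); first exact: fsubD1set.
by rewrite -cardfs_gt0 ds.
Qed.

Lemma simplicial_bnd_simp n s : is_simplex n.+1 s ->
  simplicial_bnd n (simp_elt n.+1 s) = simplicial_bnd_gen n s.
Proof. by move=> sP; rewrite /simp_elt insubT /simplicial_bnd /= lift_basis. Qed.

Lemma simplicial_bndK n (c : freemod K (simplex_of n.+2)) :
  simplicial_bnd n (simplicial_bnd n.+1 c) = 0.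
Proof.
elim/freemod_ind: c => [|a [s sP] c IHc]; first by rewrite !linear0.
rewrite !linearP IHc addr0 {1}/simplicial_bnd /= lift_basis /=.
suff -> : simplicial_bnd n (simplicial_bnd_gen n.+1 s) = 0 by rewrite scaler0.
pose F v w := (-1) ^+ (vpos v s + vpos w (s `\ v)%fset)
              *: simp_elt n (s `\ v `\ w)%fset.
pose lt v w := o v w && (v != w).
have -> : simplicial_bnd n (simplicial_bnd_gen n.+1 s) =
    \sum_(v <- s) \sum_(w <- s | w != v) F v w.
  rewrite linear_sum big_seq [RHS]big_seq; apply: eq_bigr => v vs.
  rewrite linearZ /= simplicial_bnd_simp; last exact: is_simplex_rem.
  rewrite /simplicial_bnd_gen scaler_sumr.
  rewrite (perm_big [seq w <- s | w != v]) ?big_filter; last first.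
    apply: uniq_perm; rewrite ?filter_uniq ?fset_uniq // => u.
    by rewrite mem_filter !inE.
  by apply: eq_bigr => w _; rewrite scalerA -exprD.
have -> : \sum_(v <- s) \sum_(w <- s | w != v) F v w =
    \sum_(v <- s) \sum_(w <- s | lt v w) F v w +
    \sum_(v <- s) \sum_(w <- s | lt w v) F v w.
  rewrite -big_split; apply: eq_bigr => v _ /=.
  rewrite (bigID (lt v)) /=; congr (_ + _); apply: eq_bigl => w; rewrite /lt.
    by rewrite eq_sym; case: (v =P w); rewrite ?andbF ?andbT.
  case: (w =P v) => [->|/eqP wv]; first by rewrite andbF.
  rewrite [v == w]eq_sym wv !andbT.
  have := vle_total o v w; have := @vle_anti o v w.
  case: (o v w); case: (o w v) => //= /(_ isT) vw _.
  by rewrite vw eqxx in wv.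
rewrite [X in _ + X](exchange_big_dep predT) //= -big_split /=.
rewrite big_seq big1 // => v vs; rewrite -big_split /= big_seq_cond big1 // => w.
case/andP=> ws /andP[ovw vw]; rewrite /F.
have wv : o w v = false.
  by apply: contraNF vw => owv; apply/eqP/(@vle_anti o); rewrite ovw.
rewrite (pos_rem w vs) (pos_rem v ws) ovw wv vw /= add0n.
rewrite fsetDDl fsetUC -fsetDDl.
by rewrite -addnA add1n exprS mulN1r scaleNr [in X in _ - X]addnC subrr.
Qed.

Definition simplicial_chains : complex K := Complex simplicial_bndK.

Definition simplicial_homology (n : nat) : lmodType K :=
  homology simplicial_chains n.

End SimplicialChains.

End Simplicial.

(* Main.v *)
(* A chain of [Omega_n] is a combination of maximal chains of length [n] in
   the intervals of the face poset. A maximal chain from [s] down to [s `\` T]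
   is an enumeration of [T]: the order in which the vertices are removed.
   Membership in [Omega_n] says that coefficients change sign when two
   consecutive vertices are exchanged, because exactly these two chains share
   the corresponding inner face. Hence [Omega] is free on the pairs [(s, T)] with
   [T] a proper subset of the simplex [s], i.e. it is the cubical chain complex of
   the cubical subdivision of [S], with
     d (s, T) = sum_(v in T) +- ((s \ v, T \ v) - (s, T \ v)).
   For fixed [s] the second part of [d] is the augmented simplicial boundary of
   the full simplex on [s], truncated at [T = s]; coning off a vertex contracts
   it. So [1 + dc + cd], for [c] the cone, lowers the dimension of [s] modulo the
   image of the subdivision map [s |-> sum_v +- (s, s \ v)], and a finite iterate
   pushes any chain into that image, while fixing the image pointwise. *)
Require Import Defs.
From HB Require Import structures.
From mathcomp Require Import all_boot all_algebra finmap.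
From mathcomp Require Import boolp classical_sets functions cardinality fsbigop.

Set Implicit Arguments.
Unset Strict Implicit.
Unset Printing Implicit Defensive.

Import GRing.Theory.
Local Open Scope ring_scope.

(** * Isomorphisms between quotient modules *)

Lemma linear_packP (K : pzRingType) (U W : lmodType K) (f : U -> W) :
  linear f -> exists g : {linear U -> W}, g =1 f.
Proof.
move=> fL; pose L := GRing.isLinear.Build K U W *:%R f fL.
by exists (HB.pack_for {linear U -> W} f L).
Qed.

(** Preservation of membership makes [phi] descend to the quotients, reflection of membership makes
    the induced map injective, and the second hypothesis is surjectivity modulo [Q]. *)
Lemma quotmod_iso (K : pzRingType) (M N : lmodType K)
    (P : submodClosed M) (Q : submodClosed N) (phi : {linear M -> N}) :
    (forall x, (phi x \in Q) = (x \in P)) ->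
    (forall y, exists x, y - phi x \in Q) ->
  exists f : {linear quotmod P -> quotmod Q}, bijective f.
Proof.
move=> phiQ phi_surj.
pose g (q : quotmod P) : quotmod Q := quotmod_pi Q (phi (sval (quotmod_pi_surj q))).
have gE x : g (quotmod_pi P x) = quotmod_pi Q (phi x).
  rewrite /g; case: (quotmod_pi_surj _) => y /= /quotmod_pi_eq yx.
  by apply/esym/quotmod_pi_eq; rewrite -linearB phiQ.
have gL : linear g.
  move=> a p q; case: (quotmod_pi_surj p) => x ->; case: (quotmod_pi_surj q) => y ->.
  by rewrite -linearP !gE !linearP.
have [f fg] := linear_packP gL; exists f.
have f_surj q : exists p, f p = q.
  case: (quotmod_pi_surj q) => y ->; have [x xy] := phi_surj y.
  by exists (quotmod_pi P x); rewrite fg gE; apply/esym/quotmod_pi_eq.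
have f_inj : injective f.
  move=> p q; rewrite !fg.
  case: (quotmod_pi_surj p) => x ->; case: (quotmod_pi_surj q) => y ->.
  by rewrite !gE => /quotmod_pi_eq; rewrite -linearB phiQ => /quotmod_pi_eq.
exists (fun q => sval (cid (f_surj q))) => [p|q]; last exact: (svalP (cid (f_surj _))).
by apply: f_inj; exact: (svalP (cid (f_surj _))).
Qed.

(** * Chain maps homotopic to the identity, and their iterates *)

Section Perturbation.
Variables (K : pzRingType) (C : complex K).
Variable h : forall n, {linear C n -> C n.+1}.

(** The map [1 + dh + hd]; in degree 0 the term [hd] is absent because [d] is zero there. *)
Definition perturb n : C n -> C n :=
  match n with
  | 0 => fun z => z + bnd C 0 (h 0 z)
  | m.+1 => fun z => z + bnd C m.+1 (h m.+1 z) + h m (bnd C m z)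
  end.

Lemma perturb_linear n : linear (@perturb n).
Proof.
case: n => [|n] a x y; rewrite /= !linearP ?scalerDr /=.
  by rewrite addrACA.
by rewrite (addrACA (a *: x)) [LHS]addrACA.
Qed.

(** Since [dd = 0], both sides reduce to [dz + dhdz]. *)
Lemma bnd_perturb n z : bnd C n (perturb z) = perturb (bnd C n z).
Proof.
rewrite /= !linearD bndK addr0 /=; case: n z => [|n] z //=.
by rewrite bndK linear0 addr0.
Qed.

Lemma bnd_iter_perturb n k z :
  bnd C n (iter k (@perturb n.+1) z) = iter k (@perturb n) (bnd C n z).
Proof. by elim: k => //= k IHk; rewrite -IHk -bnd_perturb. Qed.

(** On a cycle the term [hd] vanishes, so only the boundary of [h z] is added. *)
Lemma perturb_cycle n z : is_cycle z -> exists y, @perturb n z = z + bnd C n y.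
Proof.
case: n z => [|n] z; first by exists (h 0 z).
by move=> /eqP zK; exists (h n.+1 z); rewrite /= zK linear0 addr0.
Qed.

Lemma iter_perturb_cycle n k z : is_cycle z ->
  is_cycle (iter k (@perturb n) z) /\
  exists y, iter k (@perturb n) z = z + bnd C n y.
Proof.
move=> zK; elim: k => [|k [IHk [y yE]]] /=.
  by split=> //; exists 0; rewrite linear0 addr0.
have [y' y'E] := perturb_cycle IHk; split; last first.
  by exists (y + y'); rewrite y'E yE linearD addrA.
rewrite y'E; case: n z zK IHk y yE y' {y'E} => [|n] z zK IHk y yE y' //=.
by rewrite linearD bndK addr0.
Qed.

End Perturbation.

(** * A criterion for an injective chain map to induce isomorphisms on homology *)

Section HomologyIso.
Variables (K : pzRingType) (C D : complex K) (f : forall n, {linear C n -> D n}).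
Hypothesis fd : forall n x, f n (bnd C n x) = bnd D n (f n.+1 x).
Hypothesis f_inj : forall n, injective (f n).

Lemma is_cycle_map n (x : C n) : is_cycle (f n x) = is_cycle x.
Proof.
case: n x => [|n] x //=.
by rewrite -fd; apply/eqP/eqP=> [|->]; [rewrite -{1}(linear0 (f n)) => /f_inj | rewrite linear0].
Qed.

Definition cycle_map n (z : submod (@is_cycle K C n)) : submod (@is_cycle K D n) :=
  Submod (etrans (is_cycle_map (val z)) (valP z)).

Lemma cycle_map_linear n : linear (@cycle_map n).
Proof. by move=> a x y; apply: val_inj; rewrite /= linearP. Qed.

(** Because [h] kills the image of [f], [perturb] fixes that image. Iterating on a cycle gives a
    homologous cycle in the image, hence surjectivity. Iterating on a chain that bounds [f x] gives
    a chain [f c] that still bounds [f x], hence injectivity. The number of iterations may depend on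
    the chain. *)
Lemma homology_iso (h : forall n, {linear D n -> D n.+1}) :
    (forall n x, h n (f n x) = 0) ->
    (forall n z, exists k x, iter k (@perturb K D h n) z = f n x) ->
  forall n, exists g : {linear homology C n -> homology D n}, bijective g.
Proof.
move=> hf f_red n.
have iter_f k m x : iter k (@perturb K D h m) (f m x) = f m x.
  elim: k => //= k ->; case: m x => [|m] x; rewrite /= hf linear0 addr0 //.
  by rewrite -fd hf addr0.
have [phi phiE] := linear_packP (@cycle_map_linear n).
apply: (@quotmod_iso _ _ _ (@is_boundary K C n) (@is_boundary K D n) phi).
- move=> x; rewrite phiE; apply/asboolP/asboolP => -[y /= yx]; last first.
    by exists (f n.+1 y); rewrite -fd yx.
  have [k [c cE]] := f_red _ y; exists c; apply: f_inj.
  by rewrite fd -cE bnd_iter_perturb yx iter_f.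
- move=> z; have [k [c cE]] := f_red _ (val z).
  have [cK [y yE]] := iter_perturb_cycle h k (valP z).
  rewrite cE is_cycle_map in cK; exists (Submod (cK : c \in @is_cycle K C n)).
  rewrite phiE; apply/asboolP; exists (- y).
  by rewrite linearN /= -cE yE opprD addNKr.
Qed.

End HomologyIso.

(** * Sign-reversing involutions and signs of vertex removals *)

(** The predicate [p] splits [r] into two halves that [tau] exchanges. The relation
    [F (tau x) = - F x] alone would only make twice the sum vanish, and [M] may have 2-torsion. *)
Lemma big_involution0 (M : zmodType) (T : eqType) (r : seq T) (F : T -> M)
    (tau : T -> T) (p : pred T) :
    uniq r -> {in r, forall x, tau x \in r} -> {in r, involutive tau} ->
    {in r, forall x, p (tau x) = ~~ p x} ->
    {in r, forall x, F (tau x) = - F x} ->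
  \sum_(x <- r) F x = 0.
Proof.
move=> r_uniq taur tauK ptau Ftau.
have taur_perm : perm_eq [seq tau x | x <- r] r.
  apply: uniq_perm => //; first by rewrite map_inj_in_uniq //; exact: can_in_inj tauK.
  move=> x; apply/mapP/idP => [[y yr ->]|xr]; first exact: taur.
  by exists (tau x); rewrite ?tauK ?taur.
rewrite (bigID p) /= -[X in _ + X](perm_big _ taur_perm) big_map.
rewrite big_seq_cond [X in _ + X]big_seq_cond /=.
rewrite [X in _ + X](eq_big (fun x => (x \in r) && p x) (fun x => - F x)).
- by rewrite sumrN subrr.
- by move=> x; case: (boolP (x \in r)) => //= xr; rewrite ptau // negbK.
- by move=> x /andP[xr _]; rewrite Ftau.
Qed.

Section Signs.
Variables (V : choiceType) (o : vertex_order V) (K : pzRingType).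
Implicit Types (s : {fset V}) (v w : V).

Lemma vle_neq v w : v != w -> o v w = ~~ o w v.
Proof.
have := vle_total o v w; have := @vle_anti _ o v w.
by case: (o v w); case: (o w v) => //= /(_ isT) ->; rewrite eqxx.
Qed.

(** Removing the smaller vertex first lowers the position of the larger one by one; removing the
    larger first leaves the position of the smaller unchanged. *)
Lemma sign_vpos_swap s v w : v \in s -> w \in s -> v != w ->
  (-1) ^+ (vpos o v s + vpos o w (s `\ v)%fset) =
  - (-1) ^+ (vpos o w s + vpos o v (s `\ w)%fset) :> K.
Proof.
move=> vs ws vw; rewrite (pos_rem o w vs) (pos_rem o v ws) [w == v]eq_sym vw.
rewrite (vle_neq vw) !andbT; case: (o w v) => /=; rewrite ?add0n ?add1n.
  by rewrite addSn exprS mulN1r addnC.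
by rewrite addSn exprS mulN1r opprK addnC.
Qed.

(** Exactly one of the two positions drops by one, that of the larger vertex. *)
Lemma sign_vpos_rem s v w : v \in s -> w \in s -> v != w ->
  (-1) ^+ (vpos o v (s `\ w)%fset + vpos o w (s `\ v)%fset) =
  - (-1) ^+ (vpos o v s + vpos o w s) :> K.
Proof.
move=> vs ws vw; rewrite (pos_rem o w vs) (pos_rem o v ws) [w == v]eq_sym vw.
rewrite (vle_neq vw) !andbT; case: (o w v) => /=; rewrite ?add0n ?add1n.
  by rewrite addSn exprS mulN1r opprK.
by rewrite addnS exprS mulN1r opprK.
Qed.

(** The identity [dd = 0] of simplicial chains, for arbitrary values [X] on the sets: the pairs
    [(v, w)] and [(w, v)] leave the same set with opposite signs. *)
Lemma sum_vpos0 (M : lmodType K) s (X : {fset V} -> M) :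
  \sum_(v <- s) \sum_(w <- (s `\ v)%fset)
    (-1) ^+ (vpos o v s + vpos o w (s `\ v)%fset) *: X (s `\ v `\ w)%fset = 0.
Proof.
pose F p := (-1) ^+ (vpos o p.1 s + vpos o p.2 (s `\ p.1)%fset) *:
            X (s `\ p.1 `\ p.2)%fset.
transitivity (\sum_(p <- [seq (v, w) | v <- s, w <- (s `\ v)%fset]) F p).
  by rewrite big_allpairs_dep.
have mem_r p : (p \in [seq (v, w) | v <- s, w <- (s `\ v)%fset]) =
    [&& p.1 \in s, p.2 \in s & p.1 != p.2].
  apply/allpairsPdep/idP => [[v [w []]]|].
    by rewrite !inE => vs /andP[wv ws] ->; rewrite vs ws eq_sym.
  by case: p => v w /= /and3P[vs ws vw]; exists v, w; rewrite vs !inE ws eq_sym vw.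
apply: (@big_involution0 _ _ _ _ (fun p => (p.2, p.1)) (fun p => o p.1 p.2)).
- apply: allpairs_uniq_dep; rewrite ?fset_uniq // => -[v w] [v' w'] _ _ [<- <-] //.
- by move=> [v w]; rewrite !mem_r /= eq_sym => /and3P[-> -> ->].
- by move=> [v w].
- by move=> [v w]; rewrite !mem_r /= => /and3P[_ _ vw]; apply: vle_neq; rewrite eq_sym.
- move=> [v w]; rewrite !mem_r /= => /and3P[vs ws vw].
  by rewrite /F /= (sign_vpos_swap ws vs) 1?eq_sym // scaleNr fsetDDl fsetUC -fsetDDl.
Qed.

End Signs.

Lemma exchange_big_rem (V : choiceType) (M : nmodType) (s : {fset V})
    (G : V -> V -> M) :
  \sum_(v <- s) \sum_(w <- (s `\ v)%fset) G v w =
  \sum_(w <- s) \sum_(v <- (s `\ w)%fset) G v w.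
Proof.
have remE v (F : V -> M) : \sum_(w <- (s `\ v)%fset) F w = \sum_(w <- s | w != v) F w.
  rewrite -[RHS]big_filter; apply: perm_big; apply: uniq_perm; rewrite ?filter_uniq ?fset_uniq //.
  by move=> u; rewrite mem_filter !inE.
under eq_bigr do rewrite remE.
rewrite (exchange_big_dep predT) //=; apply: eq_bigr => w _.
by rewrite remE; apply: eq_bigl => v; rewrite eq_sym.
Qed.

(** * The cubical complex and the subdivision map *)

Section CellComplex.
Variables (V : choiceType) (S : simplicial_complex V) (o : vertex_order V).
Variable K : pzRingType.
Implicit Types (s T : {fset V}).

(* [(s, T)] stands for the cube of all simplices between [s `\` T] and [s]. *)
Definition is_cell n (p : {fset V} * {fset V}) : bool :=
  [&& p.1 \in (S : set {fset V}), (p.2 `<` p.1)%fset & #|` p.2| == n].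

Record cell n := Cell {
  cell_val : {fset V} * {fset V};
  cellP : is_cell n cell_val
}.

HB.instance Definition _ n := [isSub for @cell_val n].
HB.instance Definition _ n := [Choice of cell n by <:].

(** Pairs that are not cells, such as [(s, s)], give [0]; this implements the truncation at
    [T = s]. *)
Definition cell_elt n p : freemod K (cell n) :=
  if insub p is Some t then basis K t else 0.

(** For each direction [v] of the cube, the facet of simplices avoiding [v] minus the facet of
    simplices containing [v]. *)
Definition cell_bnd_gen n s T : freemod K (cell n) :=
  \sum_(v <- T) (-1) ^+ vpos o v T *:
    (cell_elt n (s `\ v, T `\ v)%fset - cell_elt n (s, T `\ v)%fset).

Definition cell_bnd n : {linear freemod K (cell n.+1) -> freemod K (cell n)} :=
  flift (fun t : cell n.+1 => cell_bnd_gen n (val t).1 (val t).2).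

Lemma cell_eltE n (t : cell n) : cell_elt n (val t) = basis K t.
Proof. by rewrite /cell_elt valK. Qed.

Lemma coef_cell_elt n (t : cell n) p : coef (cell_elt n p) t = (p == val t)%:R.
Proof.
rewrite /cell_elt; case: insubP => [u _ <-|pN].
  by rewrite coef_basis (inj_eq val_inj) eq_sym.
by case: eqP => // pE; rewrite pE (valP t) in pN.
Qed.

Lemma cell_bnd_elt n s T : is_cell n.+1 (s, T) ->
  cell_bnd n (cell_elt n.+1 (s, T)) = cell_bnd_gen n s T.
Proof. by move=> sT; rewrite /cell_elt insubT /cell_bnd /= lift_basis. Qed.

Lemma is_cell_rem n s T v : is_cell n.+1 (s, T) -> v \in T ->
  is_cell n (s, T `\ v)%fset.
Proof.
case/and3P=> /= sS Ts; rewrite (cardfsD1 v) => cT vT; rewrite vT add1n eqSS in cT.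
by rewrite /is_cell /= sS cT (fsub_proper_trans (fsubD1set _ _)).
Qed.

Lemma is_cell_rem2 n s T v : is_cell n.+1 (s, T) -> v \in T ->
  is_cell n (s `\ v, T `\ v)%fset.
Proof.
case/and3P=> /= sS Ts; rewrite (cardfsD1 v) => cT vT; rewrite vT add1n eqSS in cT.
have [Ts' /fsubsetPn[w ws wT]] := andP (etrans (esym (fproperE _ _)) Ts).
have wv : w != v by apply: contraNneq wT => ->.
rewrite /is_cell /= cT andbT; apply/andP; split.
  apply/mem_set/(simplex_sub (set_mem sS)); first exact: fsubD1set.
  by apply/fset0Pn; exists w; rewrite !inE wv.
by rewrite fproperE fsetSD //=; apply/fsubsetPn; exists w; rewrite !inE wv.
Qed.

(** The top-dimensional cubes of the subdivided simplex [s], one at each vertex [v]. *)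
Definition subdivision_gen n s : freemod K (cell n) :=
  \sum_(v <- s) (-1) ^+ vpos o v s *: cell_elt n (s, s `\ v)%fset.

(** Without the factor [(-1) ^+ n] the map would anticommute with the differentials. *)
Definition subdivision n : {linear freemod K (simplex_of S n) -> freemod K (cell n)} :=
  flift (fun t : simplex_of S n => (-1) ^+ n *: subdivision_gen n (val t)).

Lemma subdivision_basis n (t : simplex_of S n) :
  subdivision n (basis K t) = (-1) ^+ n *: subdivision_gen n (val t).
Proof. by rewrite /subdivision /= lift_basis. Qed.

Lemma is_cell_rem_simplex n s v : is_simplex S n s -> v \in s ->
  is_cell n (s, s `\ v)%fset.
Proof.
case/andP=> sS; rewrite /is_cell /= sS /sdim (cardfsD1 v s) => /[swap] vs.
by rewrite vs /= => ->; rewrite fproperD1.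
Qed.

Lemma subdivision_simp n s : is_simplex S n s ->
  subdivision n (simp_elt K S n s) = (-1) ^+ n *: subdivision_gen n s.
Proof. by move=> sP; rewrite /simp_elt insubT subdivision_basis. Qed.

(** A facet [(s, s \ v \ w)] is shared by the cubes at [v] and at [w] and cancels by [sum_vpos0].
    The facets [(s \ w, s \ w \ v)] regroup into the subdivisions of the faces [s \ w]. *)
Lemma bnd_subdivision n c :
  subdivision n (simplicial_bnd K S o n c) = cell_bnd n (subdivision n.+1 c).
Proof.
elim/freemod_ind: c => [|a [s sP] c IHc]; first by rewrite !linear0.
rewrite !linearP IHc /=; congr (a *: _ + _).
rewrite /simplicial_bnd /subdivision /= !lift_basis /=.
have -> : subdivision n (simplicial_bnd_gen K S o n s) =
    (-1) ^+ n *: \sum_(v <- s) (-1) ^+ vpos o v s *: subdivision_gen n (s `\ v)%fset.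
  rewrite linear_sum scaler_sumr big_seq [RHS]big_seq; apply: eq_bigr => v vs.
  rewrite linearZ /= subdivision_simp; last exact: is_simplex_rem sP vs.
  by rewrite !scalerA -!exprD addnC.
rewrite linearZ /= exprS mulN1r scaleNr -scalerN /=; congr (_ *: _).
transitivity (- \sum_(v <- s) (-1) ^+ vpos o v s *: cell_bnd_gen n s (s `\ v)%fset); last first.
  congr (- _); rewrite linear_sum big_seq [RHS]big_seq; apply: eq_bigr => v vs.
  by rewrite linearZ /= cell_bnd_elt //; exact: is_cell_rem_simplex.
rewrite /subdivision_gen /cell_bnd_gen.
do [under eq_bigr do rewrite scaler_sumr; under [in RHS]eq_bigr do rewrite scaler_sumr].
under [in RHS]eq_bigr => v _ do under eq_bigr => w _ do
  rewrite scalerA -exprD scalerBr.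
under [in RHS]eq_bigr => v _ do rewrite sumrB.
rewrite sumrB (sum_vpos0 o s (fun T => cell_elt n (s, T))) subr0.
rewrite [in RHS]exchange_big_rem -sumrN big_seq [RHS]big_seq.
apply: eq_bigr => v vs; rewrite -sumrN big_seq [RHS]big_seq.
apply: eq_bigr => w; rewrite !inE => /andP[wv ws].
by rewrite scalerA -exprD -scaleNr (sign_vpos_swap o K vs ws) 1?eq_sym // fsetDDl fsetUC -fsetDDl.
Qed.

End CellComplex.

(** * Maximal chains of simplices as vertex removals *)

Section RemovalPaths.
Variables (V : choiceType) (S : simplicial_complex V).
Notation G := (simplex_digraph S).
Implicit Types (x y : vtx G) (v w : V) (a : seq V).

(* junk value [x] when [x] minus [v] is not a simplex *)
Definition rem_vtx x v : vtx G := insubd x (val x `\ v)%fset.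

(** The formal arrow is the default on non-edges, so the ends are always [x] and [y]. *)
Definition step x y : mor (zcat G) :=
  if insub (x, y) : option (edge G) is Some e then inl e else inr (x, y).

Fixpoint walk x a : seq (mor (zcat G)) :=
  if a is v :: a' then step x (rem_vtx x v) :: walk (rem_vtx x v) a' else [::].

(** The strict bound on the size keeps the last simplex nonempty. *)
Definition removable x a :=
  [&& uniq a, all (fun v => v \in val x) a & (size a < #|` val x|)%N].

Lemma vtx_simplex x : (S : set {fset V}) (val x).
Proof. by apply: set_mem; exact: (svalP x). Qed.

Lemma val_rem_vtx x v : v \in val x -> (1 < #|` val x|)%N ->
  val (rem_vtx x v) = (val x `\ v)%fset.
Proof.
move=> vx cx; rewrite /rem_vtx val_insubd ifT //.
apply: mem_set; apply: (simplex_sub (vtx_simplex x)); first exact: fsubD1set.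
by rewrite -cardfs_gt0; rewrite (cardfsD1 v) vx in cx.
Qed.

Lemma rem_vtx_neq x v : v \in val x -> (1 < #|` val x|)%N -> rem_vtx x v != x.
Proof.
move=> vx cx; apply: contraTneq (vx) => xE.
by rewrite -xE val_rem_vtx ?fsetD11.
Qed.

Lemma zends_step x y : zends (step x y) = (x, y).
Proof. by rewrite /step; case: insubP => [e _ <-|]. Qed.

Lemma zdom_step x y : zdom (step x y) = x.
Proof. by rewrite /zdom zends_step. Qed.

Lemma zcod_step x y : zcod (step x y) = y.
Proof. by rewrite /zcod zends_step. Qed.

Lemma isid_step x y : x != y -> @isid (zcat G) (step x y) = false.
Proof.
move=> xy; rewrite /isid /=; apply: contraNF xy => /eqP idE.
by rewrite -{1}[x](zdom_step x y) -{2}[y](zcod_step x y) idE.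
Qed.

Lemma isid_step_rem x v : v \in val x -> (1 < #|` val x|)%N ->
  @isid (zcat G) (step x (rem_vtx x v)) = false.
Proof. by move=> vx cx; rewrite isid_step // eq_sym rem_vtx_neq. Qed.

Lemma step_rem_edge x v : v \in val x -> (1 < #|` val x|)%N ->
  @zedges G (step x (rem_vtx x v)).
Proof.
move=> vx cx; have xv : (x, rem_vtx x v) \in edge G.
  apply/mem_set; right; rewrite /= val_rem_vtx // fsubD1set; split=> //.
  by move: cx; rewrite /sdim (cardfsD1 v) vx; case: #|` _|.
by rewrite /step insubT; eexists.
Qed.

Lemma removable_cons x v a : removable x (v :: a) ->
  [/\ v \in val x, (1 < #|` val x|)%N & removable (rem_vtx x v) a].
Proof.
rewrite /removable /= => /and3P[/andP[va ua] /andP[vx ax] sa]; have cx := leq_ltn_trans (ltn0Sn _) sa.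
split=> //; rewrite val_rem_vtx // ua /=; apply/andP; split.
  apply/allP=> u ua'; rewrite !inE (allP ax) // andbT.
  by apply: contraNneq va => <-.
by move: sa; rewrite /= (cardfsD1 v) vx.
Qed.

Lemma cons_removable x v a : v \in val x -> (1 < #|` val x|)%N ->
  removable (rem_vtx x v) a -> removable x (v :: a).
Proof.
move=> vx cx; rewrite /removable val_rem_vtx // => /and3P[ua /allP ax sa] /=.
rewrite ua vx (cardfsD1 v) vx ltnS sa !andbT; apply/andP; split.
  by apply/negP=> /ax; rewrite !inE eqxx.
by apply/allP => u /ax; rewrite !inE => /andP[].
Qed.

Lemma size_walk x a : size (walk x a) = size a.
Proof. by elim: a x => //= v a IHa x; rewrite IHa. Qed.

Lemma composable_walk x a : @composable (zcat G) x (walk x a).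
Proof. by elim: a x => //= v a IHa x; rewrite zdom_step zcod_step eqxx IHa. Qed.

Lemma walk_symbol n x a : removable x a -> size a = n ->
  @is_symbol (zcat G) n (x, walk x a).
Proof.
move=> xa <-; rewrite /is_symbol /= size_walk eqxx composable_walk /=.
elim: a x xa => //= v a IHa x /removable_cons[vx cx xa].
by rewrite isid_step_rem //= IHa.
Qed.

Lemma walk_edges x a g : removable x a -> g \in walk x a -> @zedges G g.
Proof.
elim: a x => //= v a IHa x /removable_cons[vx cx xa].
by rewrite inE => /orP[/eqP->|/(IHa _ xa)//]; exact: step_rem_edge.
Qed.

Lemma rem_vtx_inj x v w : v \in val x -> w \in val x -> (1 < #|` val x|)%N ->
  rem_vtx x v = rem_vtx x w -> v = w.
Proof.
move=> vx wx cx /(congr1 val); rewrite !val_rem_vtx // => /fsetP/(_ v).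
by rewrite !inE eqxx vx andbT; case: (v =P w).
Qed.

Lemma walk_inj x a b : removable x a -> removable x b ->
  walk x a = walk x b -> a = b.
Proof.
elim: a x b => [|v a IHa] x [|w b] // /removable_cons[vx cx xa].
move=> /removable_cons[wx _ xb] /= [sE].
have vw : v = w.
  by apply: (rem_vtx_inj vx wx cx); rewrite -(zcod_step x (rem_vtx x v)) sE zcod_step.
by rewrite -vw in xb * => /IHa ->.
Qed.

(** A non-degenerate edge lowers the dimension by one, so it removes exactly one vertex; the list
    [a] collects these vertices. *)
Lemma allowed_walk x s : @composable (zcat G) x s -> ~~ has (@isid (zcat G)) s ->
  (forall g, g \in s -> @zedges G g) ->
  exists2 a, removable x a & s = walk x a.
Proof.
elim: s x => [|g s IHs] x.
  by exists [::] => //; rewrite /removable /= cardfs_gt0 (simplex_neq0 (vtx_simplex x)).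
move=> /= /andP[/eqP gx cs]; rewrite negb_or => /andP[gN sN] sE.
have [e gE] := sE g (mem_head _ _); case: e gE => -[x' y] xy gE.
have {gx} x'x : x' = x by rewrite -gx gE.
rewrite {x'}x'x in xy gE.
have yE : cod g = y by rewrite gE.
(* A degenerate edge would be an identity, which a symbol excludes. *)
case: (set_mem xy) => /= [xyE|[yx dxy]].
  by case/eqP: gN; rewrite gE /zid; congr inl; apply: val_inj; change ((x, y) = (x, x)); rewrite xyE.
have cy : (0 < #|` val y|)%N by rewrite cardfs_gt0 (simplex_neq0 (set_mem (valP y))).
have cx : (0 < #|` val x|)%N by rewrite cardfs_gt0 (simplex_neq0 (vtx_simplex x)).
have cxy : #|` val x| = (#|` val y|).+1.
  by move: dxy cx cy; rewrite /sdim; case: #|` val x| => // k; case: #|` val y| => // l /= ->.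
have /cardfs1P[v vE] : #|` (val x `\` val y)%fset| == 1%N.
  by rewrite cardfsDS // cxy subSnn.
have /andP[vy vx] : (v \notin val y) && (v \in val x).
  by have := fset11 v; rewrite -vE inE.
have c1 : (1 < #|` val x|)%N by rewrite cxy.
have {}vE : rem_vtx x v = y.
  by apply: val_inj; rewrite val_rem_vtx // -vE fsetDDr fsetDv fset0U; apply/fsetIidPr.
have [||a ya sa] := IHs y _ sN.
- by rewrite -yE.
- by move=> h hs; apply: sE; rewrite inE hs orbT.
exists (v :: a); first by apply: cons_removable; rewrite ?vE.
rewrite /= vE -sa; congr cons; rewrite gE /step insubT.
by congr inl; apply: val_inj.
Qed.

End RemovalPaths.

(** * Adjacent transpositions *)

Section Swap.
Variable T : eqType.
Implicit Types (s : seq T) (x y : T).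

Fixpoint swap k s : seq T :=
  match k, s with
  | 0, [:: x, y & s'] => [:: y, x & s']
  | k'.+1, x :: s' => x :: swap k' s'
  | _, _ => s
  end.

Lemma swap_cat s1 x y s2 :
  swap (size s1) (s1 ++ [:: x, y & s2]) = s1 ++ [:: y, x & s2].
Proof. by elim: s1 => //= z s1 ->. Qed.

Lemma split_swap k s : (k.+1 < size s)%N ->
  exists s1 x y s2, s = s1 ++ [:: x, y & s2] /\ k = size s1.
Proof.
elim: s k => // x s IHs [|k] /=; rewrite ltnS => ks.
  by case: s ks {IHs} => // y s _; exists [::], x, y, s.
have [s1 [y [z [s2 [-> ->]]]]] := IHs _ ks.
by exists (x :: s1), y, z, s2.
Qed.

Lemma perm_swap s1 x y s2 : perm_eq (s1 ++ [:: x, y & s2]) (s1 ++ [:: y, x & s2]).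
Proof. by rewrite perm_cat2l (permEl (perm_catCA [:: x] [:: y] s2)). Qed.

(** Adjacent transpositions generate all permutations: the tail is rearranged behind the head [x],
    and then [x] is moved right to its place in [t]. *)
Lemma perm_swap_ind (P : seq T -> Prop) :
    (forall s1 x y s2, P (s1 ++ [:: x, y & s2]) -> P (s1 ++ [:: y, x & s2])) ->
  forall s t, perm_eq s t -> P s -> P t.
Proof.
move=> Pswap.
have Pmove s1 s2 x s3 : P (s1 ++ x :: s2 ++ s3) -> P (s1 ++ s2 ++ x :: s3).
  elim: s2 s1 => // y s2 IHs2 s1 Ps.
  by have := IHs2 (rcons s1 y); rewrite !cat_rcons; apply; exact: Pswap.
suff Pcat s t s1 : perm_eq s t -> P (s1 ++ s) -> P (s1 ++ t) by move=> s t; exact: (Pcat s t [::]).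
elim: s t s1 => [|x s IHs] t s1 st; first by move: st; rewrite perm_sym => /perm_nilP->.
have xt : x \in t by rewrite -(perm_mem st) mem_head.
case/splitPr: xt st => t1 t2 st Ps; apply: Pmove; rewrite -cat_rcons.
apply: IHs; last by rewrite cat_rcons.
by move: st; rewrite -[x :: s]/([:: x] ++ s) -[x :: t2]/([:: x] ++ t2) perm_sym perm_catCA perm_sym perm_cons.
Qed.

End Swap.

(** * Inversions and the sign of an enumeration *)

Section Inversions.
Variables (V : choiceType) (o : vertex_order V) (K : pzRingType).
Implicit Types (v w : V) (a : seq V) (T : {fset V}).

Fixpoint inversions a : nat :=
  if a is v :: a' then count (fun u => o u v && (u != v)) a' + inversions a' else 0.

(** For a duplicate-free [a], the sign of the permutation that sorts it by [o]. *)
Definition sgn a : K := (-1) ^+ inversions a.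

Lemma sgn_sqr a : sgn a * sgn a = 1.
Proof. by rewrite -expr2 sqrr_sign. Qed.

Lemma inversions_cat a b : inversions (a ++ b) =
  (inversions a + inversions b + \sum_(v <- a) count (fun u => o u v && (u != v)) b)%N.
Proof.
elim: a => [|v a IHa] /=; first by rewrite big_nil addn0.
by rewrite IHa big_cons count_cat -!addnA; congr addn; rewrite addnCA; congr addn; rewrite addnCA.
Qed.

(** Only the pair [v], [w] changes its contribution to the inversions. *)
Lemma sgn_swap a1 v w a2 : v != w ->
  sgn (a1 ++ [:: w, v & a2]) = - sgn (a1 ++ [:: v, w & a2]).
Proof.
move=> vw; rewrite /sgn !inversions_cat.
have -> : \sum_(u <- a1) count (fun z => o z u && (z != u)) [:: w, v & a2] =
          \sum_(u <- a1) count (fun z => o z u && (z != u)) [:: v, w & a2].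
  by apply: eq_bigr => u _ /=; rewrite addnCA.
rewrite ![inversions (_ :: _ :: _)]/= [w == v]eq_sym vw !andbT (vle_neq o vw).
rewrite -!addnA [in RHS](addnCA (count _ a2)) !(exprD _ (inversions a1)) -mulrN.
by case: (o w v); rewrite /= ?add0n ?add1n exprS mulN1r ?opprK.
Qed.

Lemma sgn_cons v a T : perm_eq (v :: a) T ->
  sgn (v :: a) = (-1) ^+ vpos o v T * sgn a.
Proof.
move=> vaT; rewrite /sgn -exprD /=; congr (_ ^+ (_ + _)).
by rewrite /vpos -(permP vaT) /= eqxx andbF.
Qed.

(** The last entry [v] is inverted with the elements above it, and their number has the parity of
    [size a + vpos o v T], as [vpos] counts those below. *)
Lemma sgn_rcons v a T : uniq (v :: a) -> perm_eq (v :: a) T ->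
  sgn (rcons a v) = (-1) ^+ (size a + vpos o v T) * sgn a.
Proof.
move=> /= /andP[va _] vaT; rewrite /sgn -exprD -cats1 inversions_cat /= !addn0.
have -> : vpos o v T = count (fun u => o u v && (u != v)) a.
  by rewrite /vpos -(permP vaT) /= eqxx andbF.
rewrite -(count_predC (fun u => o u v && (u != v)) a).
rewrite [X in _ = (-1) ^+ (X + _)]addnAC !exprD -expr2.
rewrite sqrr_sign mul1r -!exprD [in LHS]addnC; congr (_ ^+ (_ + _)).
rewrite -sum1_count [RHS]big_mkcond /= big_seq [RHS]big_seq; apply: eq_bigr => u ua.
have vu : v != u by apply: contraNneq va => ->.
by rewrite addn0 [u == v]eq_sym vu (vle_neq o vu) !andbT; case: (o u v).
Qed.

End Inversions.

(** * Inner faces of walks *)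

Section Merge.
Variables (V : choiceType) (S : simplicial_complex V).
Notation G := (simplex_digraph S).
Implicit Types (x y : vtx G) (v w : V) (a : seq V).

Lemma perm_removable x a b : perm_eq a b -> removable x a = removable x b.
Proof.
by move=> ab; rewrite /removable (perm_uniq ab) (perm_size ab) (perm_all _ ab).
Qed.

Lemma removable_cat x a b : removable x (a ++ b) ->
  removable x a /\ removable (foldl (@rem_vtx V S) x a) b.
Proof.
elim: a x => [|v a IHa] x /=.
  by move=> xb; split=> //; rewrite /removable /= cardfs_gt0 (simplex_neq0 (vtx_simplex x)).
move=> /removable_cons[vx cx /IHa[xa xb]]; split=> //.
exact: cons_removable.
Qed.

(** Two consecutive steps are not identities, so their composite is the formal arrow between the
    outer ends. *)
Lemma merge_walk x a1 v w a2 (y := foldl (@rem_vtx V S) x a1)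
    (z := rem_vtx (rem_vtx y v) w) : removable x (a1 ++ [:: v, w & a2]) ->
  @merge_at (zcat G) (size a1) (walk x (a1 ++ [:: v, w & a2])) =
  walk x a1 ++ (inr (y, z) : mor (zcat G)) :: walk z a2.
Proof.
rewrite {}/z {}/y; elim: a1 x => [|u a1 IHa1] x /=.
  move=> /removable_cons[vx cx /removable_cons[wx cx' _]]; congr cons.
  have N1 := isid_step_rem vx cx.
  have N2 := isid_step_rem wx cx'.
  rewrite /zcomp -[_ == zid _]/(@isid (zcat G) _) N1.
  rewrite -[_ == zid _]/(@isid (zcat G) _) N2.
  by rewrite zdom_step zcod_step.
by move=> /removable_cons[_ _ /IHa1 <-]; case: a1 {IHa1}.
Qed.

Lemma rem_vtxC x v w a : removable x [:: v, w & a] ->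
  rem_vtx (rem_vtx x v) w = rem_vtx (rem_vtx x w) v.
Proof.
move=> xvw; have := xvw; rewrite (perm_removable _ (perm_swap [::] v w a)).
move: xvw => /removable_cons[vx cx /removable_cons[wx cvx _]].
move=> /removable_cons[wx' _ /removable_cons[vx' cwx _]].
apply: val_inj; rewrite (val_rem_vtx wx cvx) (val_rem_vtx vx cx).
by rewrite (val_rem_vtx vx' cwx) (val_rem_vtx wx' cx) fsetDDl fsetUC -fsetDDl.
Qed.

(** The formal arrow remembers only its ends, and these do not depend on the order in which [v] and
    [w] are removed. *)
Lemma merge_walk_swap x a1 v w a2 : removable x (a1 ++ [:: v, w & a2]) ->
  @merge_at (zcat G) (size a1) (walk x (a1 ++ [:: w, v & a2])) =
  @merge_at (zcat G) (size a1) (walk x (a1 ++ [:: v, w & a2])).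
Proof.
move=> xa; rewrite !merge_walk //; last by rewrite -(perm_removable _ (perm_swap _ v w _)).
by have [_ /rem_vtxC->] := removable_cat xa.
Qed.

Lemma merge_walk_last x a v : 
  @merge_at (zcat G) (size a) (walk x (rcons a v)) = walk x a.
Proof. by elim: a x => //= u a IHa x; rewrite -[in RHS]IHa; case: a {IHa}. Qed.

End Merge.

(** * Sums over enumerations of a finite set *)

Section PermutationSums.
Variables (V : choiceType) (M : nmodType).
Implicit Types (T : {fset V}) (F : seq V -> M).

Lemma big_permutations_cons T F : T != fset0 ->
  \sum_(a <- permutations T) F a =
  \sum_(v <- T) \sum_(a <- permutations (T `\ v)%fset) F (v :: a).
Proof.
rewrite -cardfs_gt0 => T0; rewrite (perm_big _ (permutationsE T0)) big_allpairs_dep /=.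
rewrite undup_id ?fset_uniq // big_seq [RHS]big_seq; apply: eq_bigr => v vT.
apply/perm_big/perm_permutations; apply: uniq_perm; rewrite ?rem_uniq ?fset_uniq //.
by move=> u; rewrite mem_rem_uniq ?fset_uniq // !inE.
Qed.

(** Rotation by one permutes the enumerations of [T] and turns the first entry into the last. *)
Lemma big_permutations_rcons T F : T != fset0 ->
  \sum_(a <- permutations T) F a =
  \sum_(v <- T) \sum_(a <- permutations (T `\ v)%fset) F (rcons a v).
Proof.
move=> T0; transitivity (\sum_(a <- permutations T) F (rot 1 a)).
  rewrite -(big_map (rot 1) predT F); apply/perm_big/uniq_perm.
  - exact: permutations_uniq.
  - by rewrite (map_inj_uniq (@rot_inj 1 _)) permutations_uniq.
  move=> a; rewrite mem_permutations; apply/idP/mapP => [aT|[b bT ->]].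
    by exists (rotr 1 a); rewrite ?rotrK // mem_permutations perm_rotr.
  by rewrite perm_rot -mem_permutations.
rewrite big_permutations_cons //; apply: eq_bigr => v _; apply: eq_bigr => a _.
by rewrite rot1_cons.
Qed.

End PermutationSums.

(** * Cubes as alternating sums of maximal chains *)

Section Cubes.
Variables (V : choiceType) (S : simplicial_complex V) (o : vertex_order V).
Variable K : pzRingType.
Notation G := (simplex_digraph S).
Implicit Types (x y : vtx G) (v w : V) (a : seq V) (T : {fset V}).

Definition walk_elt n x a : nerve K (zcat G) n := @sym_elt K (zcat G) n (x, walk x a).

(** The usual triangulation of a cube by the maximal chains of a Boolean lattice, with their
    orientation signs. *)
Definition cube_gen n x T : nerve K (zcat G) n :=
  \sum_(a <- permutations T) sgn o K a *: walk_elt n x a.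

Lemma permutation_removable n x T a : is_cell S n (val x, T) ->
  a \in permutations T -> removable x a /\ size a = n.
Proof.
case/and3P=> /= _ Tx /eqP cT; rewrite mem_permutations => aT.
have sa : size a = n by rewrite (perm_size aT).
split=> //; rewrite /removable (perm_uniq aT) fset_uniq sa -cT fproper_ltn_card //.
rewrite andbT; apply/allP => v; rewrite (perm_mem aT).
exact/fsubsetP/fproper_sub.
Qed.

(** Face [0] forgets the first removal and starts from [x] minus [v]; the last face forgets the last
    removal and still starts from [x]. All inner faces cancel in pairs. *)
Lemma bnd_cube_gen n x T : is_cell S n.+1 (val x, T) ->
  bnd (nerve K (zcat G)) n (cube_gen n.+1 x T) =
  \sum_(v <- T) (-1) ^+ vpos o v T *:
    (cube_gen n (rem_vtx x v) (T `\ v)%fset - cube_gen n x (T `\ v)%fset).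
Proof.
move=> xT; have T0 : T != fset0.
  by case/and3P: xT => _ _ /eqP cT; rewrite -cardfs_gt0 cT.
pose F i a := @sym_elt K (zcat G) n (@face (zcat G) i (x, walk x a)).
have -> : bnd (nerve K (zcat G)) n (cube_gen n.+1 x T) =
    \sum_(i < n.+2) (-1) ^+ i *: \sum_(a <- permutations T) sgn o K a *: F i a.
  rewrite linear_sum big_seq; under eq_bigr => a aT.
    have [xa sa] := permutation_removable xT aT.
    rewrite linearZ /= nerve_bnd_sym /= ?size_walk ?composable_walk //.
    rewrite /nerve_bnd_gen scaler_sumr.
    over.
  rewrite -big_seq exchange_big /=; apply: eq_bigr => i _.
  rewrite scaler_sumr; apply: eq_bigr => a _.
  by rewrite !scalerA /sgn -!exprD addnC.
rewrite big_ord_recl big_ord_recr /= [X in _ + (X + _)]big1 ?add0r => [|i _].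
  rewrite expr0 scale1r big_permutations_cons // big_permutations_rcons //.
  rewrite scaler_sumr -big_split /= big_seq [RHS]big_seq; apply: eq_bigr => v vT.
  have vaT a : a \in permutations (T `\ v)%fset -> perm_eq (v :: a) T.
    rewrite mem_permutations => aT; apply: uniq_perm; rewrite ?fset_uniq //=.
      by rewrite (perm_mem aT) (perm_uniq aT) fset_uniq !inE eqxx.
    by move=> u; rewrite !inE (perm_mem aT) !inE; case: (u =P v) => // ->.
  rewrite scalerBr; congr (_ + _).
    rewrite scaler_sumr big_seq [RHS]big_seq; apply: eq_bigr => a aT.
    by rewrite (sgn_cons o K (vaT a aT)) scalerA /F /face /= zcod_step.
  rewrite -scalerN scaler_sumr -sumrN scaler_sumr big_seq [RHS]big_seq.
  apply: eq_bigr => a aT; have va := vaT a aT.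
  have va_uniq : uniq (v :: a) by rewrite (perm_uniq va) fset_uniq.
  have sa : size a = n.
    have [_] := permutation_removable xT (etrans (mem_permutations _ _) va).
    by case.
  (* The sign [(-1) ^+ n.+1] of the last face meets the factor [(-1) ^+ n] from moving [v] to the
     end, which leaves a minus. *)
  rewrite (sgn_rcons o K va_uniq va) -scaleNr !scalerA sa /F.
  have -> : @face (zcat G) (bump 0 n) (x, walk x (rcons a v)) = (x, walk x a).
    by rewrite /face /= add0n -sa merge_walk_last.
  congr (_ *: _); rewrite /sgn mulrN -!exprD exprD -addnA exprD mulrA.
  by rewrite /bump /= add1n exprS mulN1r !mulNr -expr2 sqrr_sign mul1r.
(* Face [k.+1] composes the entries [k] and [k.+1], so exchanging these two vertices keeps the face
   and reverses the sign. The order of the two vertices separates the halves that the exchange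
   matches. *)
rewrite /bump /= add1n; set k := nat_of_ord i.
rewrite (@big_involution0 _ _ _ _ (swap k)
  (fun a => if drop k a is [:: v, w & _] then o v w else false)) ?scaler0 //.
- exact: permutations_uniq.
all: move=> a aT; have [xa sa] := permutation_removable xT aT.
all: have [a1 [v [w [a2 [aE kE]]]]] : exists a1 v w a2, a = a1 ++ [:: v, w & a2] /\ k = size a1
  by apply: split_swap; rewrite sa ltnS ltn_ord.
all: have vw : v != w
  by case/and3P: xa; rewrite aE cat_uniq /= => /and4P[_ _]; rewrite inE negb_or => /andP[].
all: rewrite aE kE ?swap_cat ?drop_size_cat //.
- by rewrite mem_permutations -(permPl (perm_swap a1 v w a2)) -mem_permutations -aE.
- by apply: vle_neq; rewrite eq_sym.
- by rewrite (sgn_swap o K a1 a2 vw) scaleNr /F /face /= merge_walk_swap // -aE.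
Qed.

End Cubes.

(** * Coefficients in free modules *)

Section FreeModuleCoefficients.
Variables (K : pzRingType) (T : choiceType).

Lemma freemod_coef_sum (I : Type) (r : seq I) (F : I -> freemod K T) t :
  coef (\sum_(i <- r) F i) t = \sum_(i <- r) coef (F i) t.
Proof. by rewrite (big_morph (fun x => coef x t : K) (id1 := 0) (op1 := +%R)). Qed.

Lemma freemod_coefZ a (x : freemod K T) t : coef (a *: x) t = a * coef x t.
Proof. by []. Qed.

Lemma freemod_coefD (x y : freemod K T) t : coef (x + y) t = coef x t + coef y t.
Proof. by []. Qed.

Lemma freemod_coef0 t : coef (0 : freemod K T) t = 0.
Proof. by []. Qed.

(** Induction on [x] would lose control of its support, so both maps are first written as [flift], a
    sum weighted by the coefficients of [x]. *)
Lemma coef_sub_ind (M : lmodType K) (f g : {linear freemod K T -> M}) x :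
  (forall t, coef x t != 0 -> f (basis K t) = g (basis K t)) -> f x = g x.
Proof.
have liftf (h : {linear freemod K T -> M}) y : h y = flift (fun t => h (basis K t)) y.
  elim/freemod_ind: y => [|a t y IHy]; first by rewrite !linear0.
  by rewrite !linearP IHy /= lift_basis.
move=> fg; rewrite (liftf f x) (liftf g x) /flift; apply: eq_fsbigr => t _ /=.
by have [->|/fg->] := eqVneq (coef x t) 0; rewrite ?scale0r.
Qed.

End FreeModuleCoefficients.

(** * The injective chain map from cells to the nerve *)

Section CubeMap.
Variables (V : choiceType) (S : simplicial_complex V) (o : vertex_order V).
Variable K : comPzRingType.
Notation G := (simplex_digraph S).
Implicit Types (x y : vtx G) (v w : V) (a : seq V) (T : {fset V}).

Lemma cell_simplex n (t : cell S n) : (val t).1 \in (S : set {fset V}).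
Proof. by case/and3P: (valP t). Qed.

Definition cell_vtx n (t : cell S n) : vtx G := exist _ (val t).1 (cell_simplex t).

Definition cube n : {linear freemod K (cell S n) -> nerve K (zcat G) n} :=
  flift (fun t : cell S n => cube_gen o K n (cell_vtx t) (val t).2).

Lemma cell_vtxE n (t : cell S n) : val t = (val (cell_vtx t), (val t).2).
Proof. exact: surjective_pairing. Qed.

Lemma cube_elt n x T : is_cell S n (val x, T) ->
  cube n (cell_elt S K n (val x, T)) = cube_gen o K n x T.
Proof.
move=> xT; rewrite -[(val x, T)]/(val (Cell xT)) cell_eltE /cube /= lift_basis /=.
by congr cube_gen; apply: val_inj.
Qed.

Lemma bnd_cube n c : bnd (nerve K (zcat G)) n (cube n.+1 c) = cube n (cell_bnd S o K n c).
Proof.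
elim/freemod_ind: c => [|a t c IHc]; first by rewrite !linear0.
rewrite !linearP IHc /=; congr (a *: _ + _).
have tc : is_cell S n.+1 (val (cell_vtx t), (val t).2) := valP t.
rewrite -[basis K t]cell_eltE [val t]cell_vtxE cube_elt // bnd_cube_gen //.
rewrite cell_bnd_elt // linear_sum big_seq [RHS]big_seq; apply: eq_bigr => v vT.
rewrite [RHS]linearZ /=; congr (_ *: _); rewrite [RHS]linearB /=; congr (_ - _).
  have vx : v \in val (cell_vtx t) by case/and3P: tc => _ /fproper_sub /fsubsetP/(_ _ vT).
  have cx : (1 < #|` val (cell_vtx t)|)%N.
    by case/and3P: tc => _ /fproper_ltn_card /= tx /eqP cT; apply: leq_ltn_trans tx; rewrite cT.
  by rewrite -cube_elt val_rem_vtx //; exact: is_cell_rem2 tc vT.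
by rewrite -cube_elt //; exact: is_cell_rem tc vT.
Qed.

Lemma cube_allowed n c : cube n c \in @allowed K (zcat G) (@zedges G) n.
Proof.
elim/freemod_ind: c => [|a t c IHc]; first by rewrite linear0 rpred0.
rewrite linearP rpredD ?rpredZ //= lift_basis /cube_gen big_seq rpred_sum // => b bT.
have [xb sb] := permutation_removable (valP t : is_cell S n (val (cell_vtx t), _)) bT.
rewrite rpredZ //; apply/asboolP => u; rewrite /walk_elt /sym_elt insubT => [|xP].
  exact: walk_symbol.
rewrite coef_basis; case: (u =P _) => [-> _ g|]; last by rewrite eqxx.
exact: walk_edges.
Qed.

(** The boundary of a combination of cubes is again one, hence allowed. *)
Lemma cube_omega n c : cube n c \in @omega_pred K (zcat G) (@zedges G) n.
Proof.
case: n c => [|n] c; first exact: cube_allowed.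
by apply/andP; split; rewrite ?bnd_cube cube_allowed.
Qed.

Lemma coef_sym_elt n (u : symbol (zcat G) n) p :
  coef (sym_elt K n p) u = (p == val u)%:R.
Proof.
rewrite /sym_elt; case: insubP => [t _ <-|pN].
  by rewrite coef_basis (inj_eq val_inj) eq_sym.
by case: eqP => // pE; rewrite pE (valP u) in pN.
Qed.

(** A walk determines its source and its sequence of removed vertices, hence the cell and the
    enumeration; a single summand contributes. *)
Lemma coef_cube n c (t : cell S n) (u : symbol (zcat G) n) a :
    perm_eq a (val t).2 -> val u = (cell_vtx t, walk (cell_vtx t) a) ->
  coef (cube n c) u = sgn o K a * coef c t.
Proof.
move=> aT uE; have ta : a \in permutations (val t).2 by rewrite mem_permutations.
have tc : is_cell S n (val (cell_vtx t), (val t).2) := valP t.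
have [xa _] := permutation_removable tc ta.
elim/freemod_ind: c => [|b t' c IHc]; first by rewrite linear0 !freemod_coef0 mulr0.
rewrite linearP !freemod_coefD !freemod_coefZ IHc mulrDr /= lift_basis; congr (_ + _).
rewrite mulrCA; congr (_ * _); rewrite /cube_gen freemod_coef_sum.
under eq_bigr do rewrite freemod_coefZ coef_sym_elt uE.
have [<-|tt'] := eqVneq t t'.
  rewrite (bigD1_seq a) ?permutations_uniq //= eqxx big1_seq ?addr0 // => b' /andP[b'a b't].
  have [xb _] := permutation_removable tc b't.
  by case: eqP => [[/(walk_inj xb xa) E]|_]; [rewrite E eqxx in b'a | rewrite mulr0].
rewrite mulr0 big1_seq // => b' /andP[_ bt].
have tc' : is_cell S n (val (cell_vtx t'), (val t').2) := valP t'.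
have [xb _] := permutation_removable tc' bt.
case: eqP => [tbE|_]; last by rewrite mulr0.
have tE : cell_vtx t' = cell_vtx t := congr1 fst tbE.
have bE : walk (cell_vtx t') b' = walk (cell_vtx t) a := congr1 snd tbE.
rewrite tE in bE xb; case/eqP: tt'; apply: val_inj.
rewrite [LHS]cell_vtxE [RHS]cell_vtxE tE; congr (_, _).
apply/fsetP => v; rewrite -(perm_mem aT) -(walk_inj xb xa bE).
by move: bt; rewrite mem_permutations => /perm_mem->.
Qed.

Lemma cell_symbol_subproof n (t : cell S n) :
  @is_symbol (zcat G) n (cell_vtx t, walk (cell_vtx t) (val t).2).
Proof.
have tc : is_cell S n (val (cell_vtx t), (val t).2) := valP t.
have [|xa sa] := permutation_removable (a := (val t).2) tc; last exact: walk_symbol.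
by rewrite mem_permutations.
Qed.

(** A representative walk of the cell, in the order in which the finite set lists its elements;
    coefficients are read off there. *)
Definition cell_symbol n (t : cell S n) : symbol (zcat G) n :=
  Symbol (cell_symbol_subproof t).

Lemma cube_inj n : injective (cube n).
Proof.
move=> c c' cc'; apply: coefP => t.
have E d : coef d t = sgn o K (val t).2 * coef (cube n d) (cell_symbol t).
  by rewrite (coef_cube d (t := t) (a := (val t).2)) // mulrA sgn_sqr mul1r.
by rewrite E cc' -E.
Qed.

End CubeMap.

(** The separator is the first entry violating [P]. With [P] the property of being an edge, this
    locates the formal arrow in an inner face. *)
Lemma cat_cons_inj (T : eqType) (P : pred T) (s1 s2 t1 t2 : seq T) x y :
    all P s1 -> all P t1 -> ~~ P x -> ~~ P y ->
    s1 ++ x :: s2 = t1 ++ y :: t2 ->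
  [/\ s1 = t1, x = y & s2 = t2].
Proof.
elim: s1 t1 => [|z s1 IHs] [|w t1] //=.
- by move=> _ _ _ _ [-> ->].
- by move=> _ /andP[Pw _] Px _ [xw]; rewrite xw Pw in Px.
- by move=> /andP[Pz _] _ _ Py [zy]; rewrite -zy Pz in Py.
by move=> /andP[_ Ps] /andP[_ Pt] Px Py [-> /(IHs _ Ps Pt Px Py)[-> -> ->]].
Qed.

(** * Coefficients of chains in [omega] alternate *)

Section OmegaAlternating.
Variables (V : choiceType) (S : simplicial_complex V).
Variable K : comPzRingType.
Notation G := (simplex_digraph S).
Implicit Types (x y : vtx G) (v w : V) (a : seq V).

Definition is_edge (g : mor (zcat G)) : bool := if g is inl _ then true else false.

Lemma is_edgeP g : reflect (@zedges G g) (is_edge g).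
Proof. by case: g => [e|z]; constructor; [exists e | case]. Qed.

Lemma all_is_edge_walk x a : removable x a -> all is_edge (walk x a).
Proof. by move=> xa; apply/allP => g /(walk_edges xa)/is_edgeP. Qed.

(** An interval of length two in the face poset has only two maximal chains. *)
Lemma rem2_vtx_inj x v w v' w' a a' :
    removable x [:: v, w & a] -> removable x [:: v', w' & a'] ->
    rem_vtx (rem_vtx x v) w = rem_vtx (rem_vtx x v') w' ->
  v' = v /\ w' = w \/ v' = w /\ w' = v.
Proof.
move=> /removable_cons[vx cx /removable_cons[wx cvx _]].
move=> /removable_cons[v'x _ /removable_cons[w'x cv'x _]] /(congr1 val).
rewrite (val_rem_vtx wx cvx) (val_rem_vtx vx cx) (val_rem_vtx w'x cv'x) (val_rem_vtx v'x cx).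
rewrite (val_rem_vtx vx cx) !inE in wx; rewrite (val_rem_vtx v'x cx) !inE in w'x.
move: wx w'x => /andP[wv wx] /andP[wv' w'x] /fsetP E.
have /orP[/eqP vE|/eqP vE] : (v == w') || (v == v').
  by move: (E v); rewrite !inE eqxx vx /= andbF andbT => /esym/negbT; rewrite negb_and !negbK.
all: have /orP[/eqP wE|/eqP wE] : (w == w') || (w == v')
  by move: (E w); rewrite !inE ?eqxx ?wx /= ?andbT => /esym/negbT; rewrite negb_and !negbK.
- by case/eqP: wv; rewrite vE wE.
- by right.
- by left.
- by case/eqP: wv; rewrite vE wE.
Qed.

(** The outer faces of a walk consist of edges, whereas [q] contains a formal arrow. Its position
    gives [k] and the prefix [a1], and its ends give [v] and [w] up to order. *)
Lemma face_walkE n x y b a1 v w a2 (a := a1 ++ [:: v, w & a2])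
    (q := @face (zcat G) (size a1).+1 (x, walk x a)) k :
    size b = n.+1 -> (k < n.+2)%N -> removable x a -> removable y b ->
  (@face (zcat G) k (y, walk y b) == q) =
  [&& k == (size a1).+1, y == x & (b == a) || (b == a1 ++ [:: w, v & a2])].
Proof.
move=> sb kn xa yb.
have qE : q = (x, walk x a1 ++
    (inr (foldl (@rem_vtx V S) x a1, foldl (@rem_vtx V S) x (a1 ++ [:: v; w])) : mor (zcat G))
    :: walk (foldl (@rem_vtx V S) x (a1 ++ [:: v; w])) a2).
  by rewrite /q /face /= merge_walk // foldl_cat.
have q_edge : ~~ all is_edge q.2 by rewrite qE all_cat /= andbF.
apply/eqP/and3P => [E|[/eqP-> /eqP-> /orP[]/eqP->]]; last 2 first.
- by [].
- by rewrite /q /face /= merge_walk_swap.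
case: k kn E => [|k] kn E.
  case: b sb yb E => //= u b _ /removable_cons[_ _ /all_is_edge_walk ub] E.
  by rewrite -E /= in q_edge; rewrite ub in q_edge.
move: kn; rewrite !ltnS leq_eqVlt => /orP[/eqP kn|kn].
  case: (lastP b) sb yb E => [//|b' u]; rewrite size_rcons => -[sb] /=.
  rewrite -cats1 => /removable_cat[/all_is_edge_walk yb _] E.
  by rewrite -E /face /= cats1 kn -sb merge_walk_last yb in q_edge.
have [|b1 [v' [w' [b2 [bE kE]]]]] := @split_swap _ k b; first by rewrite sb.
rewrite bE kE in E yb *.
move: E; rewrite qE /face /= merge_walk // => yxE.
have {yxE} [yx wE] : y = x /\ _ := conj (congr1 fst yxE) (congr1 snd yxE).
rewrite yx /= in wE yb *.
have [xa1 xa2] := removable_cat xa; have [yb1 yb2] := removable_cat yb.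
have [] := cat_cons_inj (all_is_edge_walk yb1) (all_is_edge_walk xa1) _ _ wE => //.
move=> /(walk_inj yb1 xa1) b1E; rewrite {}b1E in wE yb yb1 yb2 *.
case=> zE; rewrite foldl_cat /= in zE *; rewrite -zE => b2E.
have Eb := rem2_vtx_inj xa2 yb2 (esym zE).
move: yb2 xa2 => /removable_cons[_ _ /removable_cons[_ _ yb2]].
move=> /removable_cons[_ _ /removable_cons[_ _ xa2]].
rewrite -zE in xa2; rewrite (walk_inj yb2 xa2 b2E).
by case: Eb => -[-> ->]; split; rewrite // eqxx ?orbT.
Qed.

(** Total in [a], with [0] when the walk is not a symbol, so that linearity in [z] needs no side
    condition. *)
Definition walk_coef n (z : nerve K (zcat G) n) x a : K :=
  if (insub ((x, walk x a) : obj (zcat G) * seq (mor (zcat G))) : option (symbol (zcat G) n)) is Some t then coef z t else 0.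

Lemma walk_coef_linear n x a b (z z' : nerve K (zcat G) n) :
  walk_coef (b *: z + z') x a = b * walk_coef z x a + walk_coef z' x a.
Proof. by rewrite /walk_coef; case: insubP => // _; rewrite mulr0 addr0. Qed.

Lemma walk_coef_basis n (u : symbol (zcat G) n) x a : removable x a -> size a = n ->
  walk_coef (basis K u) x a = (val u == (x, walk x a))%:R.
Proof.
move=> xa sa; rewrite /walk_coef insubT => [|xP]; first exact: walk_symbol.
by rewrite coef_basis -(inj_eq val_inj) /= eq_sym.
Qed.

Lemma inner_face_symbol n x a1 v w a2 (a := a1 ++ [:: v, w & a2]) :
  removable x a -> size a = n.+1 ->
  let q := @face (zcat G) (size a1).+1 (x, walk x a) in
  is_symbol n q /\ ~~ all is_edge q.2.
Proof.
move=> xa sa q; have qE : q.2 = walk x a1 ++ _ := merge_walk xa.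
split; last by rewrite qE all_cat /= andbF.
have aS : ((size a1).+1 < size a)%N by rewrite /a size_cat /= !addnS !ltnS leq_addr.
apply/and3P; split.
- by rewrite size_face ?size_walk ?sa // -sa ltnW.
- by apply: composable_face; exact: composable_walk.
have walkN y b : removable y b -> ~~ has (@isid (zcat G)) (walk y b).
  by move=> yb; case/and3P: (walk_symbol yb (erefl (size b))).
have [xa1 /removable_cons[_ _ /removable_cons[_ _ xa2]]] := removable_cat xa.
by rewrite qE has_cat negb_or walkN //=; exact: walkN.
Qed.

(** By [face_walkE] the coefficient of the common inner face in the boundary of [z] is, up to sign,
    the sum of the two walk coefficients; it is zero because that face contains a formal arrow. *)
Lemma omega_swap n (z : nerve K (zcat G) n.+1) x a1 v w a2 :
    z \in @omega_pred K (zcat G) (@zedges G) n.+1 ->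
    removable x (a1 ++ [:: v, w & a2]) -> size (a1 ++ [:: v, w & a2]) = n.+1 ->
  walk_coef z x (a1 ++ [:: w, v & a2]) = - walk_coef z x (a1 ++ [:: v, w & a2]).
Proof.
move=> /andP[/asboolP z_allowed /asboolP bz_allowed] xa sa.
have [qP qN] := inner_face_symbol xa sa; set q := face _ _ in qP qN.
have kn : ((size a1).+1 < n.+2)%N by rewrite -sa size_cat /= !addnS !ltnS leqW ?leq_addr.
set a := a1 ++ _ in xa sa q qP qN *; set a' := a1 ++ _.
have xa' : removable x a' by rewrite -(perm_removable _ (perm_swap a1 v w a2)).
have sa' : size a' = n.+1 by rewrite -sa /a /a' !size_cat.
have bz0 : coef (bnd (nerve K (zcat G)) n z) (Symbol qP) = 0.
  apply/eqP; apply: contraNT qN => /bz_allowed /= qE.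
  by apply/allP => g /qE /is_edgeP.
have aa' : a != a'.
  rewrite /a /a' eqseq_cat // eqxx /= !eqseq_cons; case: eqP => //= vw.
  by case/and3P: xa; rewrite cat_uniq vw /= inE eqxx !andbF.
have /linear_packP[f fE] :
    linear (fun y : nerve K (zcat G) n.+1 => coef (bnd (nerve K (zcat G)) n y) (Symbol qP) : K^o).
  by move=> b y y'; rewrite linearP freemod_coefD freemod_coefZ.
have /linear_packP[g gE] : linear (fun y : nerve K (zcat G) n.+1 =>
    (-1) ^+ (size a1).+1 * (walk_coef y x a + walk_coef y x a') : K^o).
  move=> b y y'; by rewrite !walk_coef_linear addrACA -(mulrDr b) (mulrDr (_ ^+ _)) (mulrCA _ b).
(* Both functionals are linear, so it suffices to compare them on the support of [z], whose symbols
   are walks because [z] is allowed. *)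
have : f z = g z.
  apply: coef_sub_ind => u /z_allowed uE; rewrite fE gE /= lift_basis.
  have /and3P[/eqP su cu uN] := valP u.
  have [b yb uwalk] := allowed_walk cu uN uE.
  have sb : size b = n.+1 by rewrite -(size_walk (val u).1) -uwalk.
  have {uwalk cu uN uE su} uE : val u = ((val u).1, walk (val u).1 b).
    by rewrite -uwalk -surjective_pairing.
  move: (val u).1 yb uE => y yb uE.
  rewrite !walk_coef_basis // /nerve_bnd_gen uE freemod_coef_sum.
  under eq_bigr => k _ do rewrite freemod_coefZ coef_sym_elt /= (face_walkE sb (ltn_ord k) xa yb).
  rewrite (bigD1 (Ordinal kn)) //= eqxx /= big1 => [|k]; last first.
    by rewrite -val_eqE /= => /negPf->; rewrite mulr0.
  have walkE c : removable x c ->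
      ((y, walk y b) == (x, walk x c) :> obj (zcat G) * seq (mor (zcat G))) =
      (y == x) && (b == c).
    move=> xc; apply/eqP/andP => [E|[/eqP-> /eqP->] //].
    have yx : y = x := congr1 fst E; have bc : walk y b = walk x c := congr1 snd E.
    by rewrite yx in yb bc *; rewrite (walk_inj yb xc bc).
  rewrite -[symbol_val u]/(val u) !uE addr0 !walkE //; congr (_ * _); case: (y == x) => /=; last by rewrite addr0.
  by case: (b =P a) => [->|_]; rewrite ?(negPf aa') ?addr0 ?add0r.
rewrite fE gE bz0 => /esym/(congr1 ( *%R ((-1) ^+ (size a1).+1))).
by rewrite mulrA -expr2 sqrr_sign mul1r mulr0 addrC => /eqP; rewrite addr_eq0 => /eqP.
Qed.

End OmegaAlternating.

(** * Surjectivity of the cube map onto [omega] *)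

Section CubeMapIso.
Variables (V : choiceType) (S : simplicial_complex V) (o : vertex_order V).
Variable K : comPzRingType.
Notation G := (simplex_digraph S).
Implicit Types (x y : vtx G) (v w : V) (a : seq V) (T : {fset V}).

(** An adjacent exchange reverses both factors, and such exchanges reach every enumeration. *)
Lemma omega_perm n (z : nerve K (zcat G) n) x a b :
    z \in @omega_pred K (zcat G) (@zedges G) n ->
    removable x a -> size a = n -> perm_eq a b ->
  sgn o K b * walk_coef z x b = sgn o K a * walk_coef z x a.
Proof.
move=> zO xa sa ab; pose P c := perm_eq a c -> sgn o K c * walk_coef z x c = sgn o K a * walk_coef z x a.
suff : P b by exact.
apply: (@perm_swap_ind _ P _ a b ab) => // s1 v w s2 Ps as12.
have as12' : perm_eq a (s1 ++ [:: v, w & s2]).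
  by rewrite (permPl as12) perm_swap.
rewrite -(Ps as12'); have xs := xa; rewrite (perm_removable _ as12') in xs.
have ss : size (s1 ++ [:: v, w & s2]) = n by rewrite -(perm_size as12').
have vw : v != w.
  by case/and3P: xs; rewrite cat_uniq /= => /and4P[_ _]; rewrite inE negb_or => /andP[].
case: n z zO sa ss {Ps P} => [|n] z zO sa ss; first by rewrite size_cat /= addnS in ss.
by rewrite (sgn_swap o K s1 s2 vw) (omega_swap zO xs ss) mulrNN.
Qed.

Lemma cell_symbol_inj n : injective (@cell_symbol V S n).
Proof.
move=> t t' /(congr1 val) /= tE.
have xE : cell_vtx t = cell_vtx t' := congr1 fst tE.
have wE : walk (cell_vtx t) (val t).2 = walk (cell_vtx t') (val t').2 := congr1 snd tE.
apply: val_inj; rewrite [LHS]cell_vtxE [RHS]cell_vtxE xE; congr (_, _).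
have tc : is_cell S n (val (cell_vtx t), (val t).2) := valP t.
have tc' : is_cell S n (val (cell_vtx t'), (val t').2) := valP t'.
have [|xT _] := permutation_removable (a := (val t).2) tc; first by rewrite mem_permutations.
have [|xT' _] := permutation_removable (a := (val t').2) tc'; first by rewrite mem_permutations.
rewrite xE in xT wE; have TE := walk_inj xT xT' wE.
by apply/fsetP => v; rewrite -[LHS]/(v \in enum_fset _) TE.
Qed.

Lemma cube_surj n (z : nerve K (zcat G) n) :
  z \in @omega_pred K (zcat G) (@zedges G) n -> exists c, cube S o K n c = z.
Proof.
move=> zO; have z_allowed : z \in @allowed K (zcat G) (@zedges G) n.
  by case: n z zO => [//|n] z /andP[].
(* The coefficient at a cell is read from its representative walk; injectivity of [cell_symbol]
   makes the support finite. *)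
have supp_c : (fun t : cell S n => sgn o K (val t).2 * coef z (cell_symbol t) : K^o)
    \in fin_supp (K := K) (T := cell S n).
  apply/asboolP; have : finite_set (@cell_symbol V S n @^-1` [set u | coef z u != 0])%classic.
    apply: finite_preimage (finite_coef z) => t t' _ _; exact: cell_symbol_inj.
  apply: sub_finite_set => t /=; apply: contraNneq => ->; by rewrite mulr0.
exists (Submod supp_c); apply: coefP => u.
have [/allP uE|uN] := boolP (all (@is_edge V S) (val u).2); last first.
  have c0 d : d \in @allowed K (zcat G) (@zedges G) n -> coef d u = 0.
    move=> /asboolP dE; apply/eqP; apply: contraNT uN => /dE uE.
    by apply/allP => g /uE/is_edgeP.
  by rewrite !c0 // cube_allowed.
have /and3P[/eqP su cu uN] := valP u.
have [b yb uwalk] := allowed_walk cu uN (fun g gu => elimT (is_edgeP g) (uE g gu)).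
have sb : size b = n by rewrite -(size_walk (val u).1) -uwalk.
have {uwalk cu uN uE su} uE : val u = ((val u).1, walk (val u).1 b).
  by rewrite -uwalk -surjective_pairing.
move: (val u).1 yb uE => y yb uE.
(* The walk belongs to the cell with top [y] whose directions are the vertices it removes. *)
pose T := [fset v | v in b]%fset.
have bT : perm_eq b T.
  apply: uniq_perm; rewrite ?fset_uniq //; first by case/and3P: yb.
  by move=> v; rewrite in_fset.
have yT : is_cell S n (val y, T).
  rewrite /is_cell /= -(perm_size bT) sb eqxx andbT; apply/andP; split.
    exact/mem_set/vtx_simplex.
  rewrite fproperEcard -(perm_size bT); case/and3P: yb => _ /allP bx ->.
  by rewrite andbT; apply/fsubsetP => v; rewrite -(perm_mem bT) => /bx.
have tyE : cell_vtx (Cell yT) = y by apply: val_inj.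
rewrite (@coef_cube _ _ o _ _ _ (Cell yT) u b) ?tyE //.
have cE t : coef (Submod supp_c) t = sgn o K (val t).2 * coef z (cell_symbol t) by [].
rewrite cE /= -[RHS]mul1r -(sgn_sqr o K b) -mulrA; congr (_ * _).
have wE c (w : symbol (zcat G) n) : val w = (y, walk y c) -> coef z w = walk_coef z y c.
  by move=> wE; rewrite /walk_coef -wE valK.
by rewrite (wE T) /= ?tyE // (wE b) // (omega_perm zO yb sb bT).
Qed.

End CubeMapIso.

(** * Homology of the cell complex and the cone operator *)

Section CellHomology.
Variables (V : choiceType) (S : simplicial_complex V) (o : vertex_order V).
Variable K : comPzRingType.
Notation G := (simplex_digraph S).
Implicit Types (s T : {fset V}) (u v w : V).

(** Inherited from the nerve along the injective map [cube]. *)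
Lemma cell_bndK n (c : freemod K (cell S n.+2)) :
  cell_bnd S o K n (cell_bnd S o K n.+1 c) = 0.
Proof. by apply: (@cube_inj _ _ o); rewrite linear0 -!bnd_cube bndK. Qed.

Definition cell_complex : complex K := Complex cell_bndK.

Definition cube_map n (c : cell_complex n) : omega_sc G K n :=
  Submod (cube_omega o c).

Lemma cube_map_linear n : linear (@cube_map n).
Proof. by move=> a x y; apply: val_inj; rewrite /= linearP. Qed.

HB.instance Definition _ n := GRing.isLinear.Build K (cell_complex n)
  (omega_sc G K n) *:%R (@cube_map n) (@cube_map_linear n).

Lemma cell_homology_sc n :
  exists f : {linear homology cell_complex n -> homology_sc G K n}, bijective f.
Proof.
have cube_mapd m (c : cell_complex m.+1) :
    cube_map (bnd cell_complex m c) = bnd (omega_sc G K) m (cube_map c).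
  by apply: val_inj; rewrite /= bnd_cube.
have cube_map_inj m : injective (@cube_map m).
  by move=> c c' /(congr1 val) /= /cube_inj.
(* The map [cube_map] is already onto, so the zero homotopy and no iteration suffice. *)
pose h m : {linear omega_sc G K m -> omega_sc G K m.+1} := \0.
apply: (homology_iso cube_mapd cube_map_inj (h := h)) => // m z.
by exists 0%N; have [c cE] := cube_surj o (valP z); exists c; apply: val_inj.
Qed.

(* Junk value [0] when [s] is empty; the cell vanishes when it would be [(s, s)]. *)
Definition cone_gen n s T : freemod K (cell S n) :=
  if ohead s is Some v0 then
    if v0 \in T then 0 else (-1) ^+ vpos o v0 (v0 |` T)%fset *: cell_elt S K n (s, v0 |` T)%fset
  else 0.

Definition cone n : {linear freemod K (cell S n) -> freemod K (cell S n.+1)} :=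
  flift (fun t : cell S n => cone_gen n.+1 (val t).1 (val t).2).

Lemma cone_elt n s T : is_cell S n (s, T) ->
  cone n (cell_elt S K n (s, T)) = cone_gen n.+1 s T.
Proof. by move=> sT; rewrite /cell_elt insubT /cone /= lift_basis. Qed.

Lemma cell_elt0 n s T : ~~ is_cell S n (s, T) -> cell_elt S K n (s, T) = 0.
Proof. by move=> sT; rewrite /cell_elt insubN. Qed.

(* The augmented simplicial chain complex of the full simplex on [s] is
   contractible; the last term is the boundary of the cone on [T], which survives
   even when that cone is the excluded cell [(s, s)]. *)
Lemma cone_homotopy n s T v0 : ohead s = Some v0 ->
  \sum_(v <- T) (-1) ^+ vpos o v T *: cone_gen n s (T `\ v)%fset =
  cell_elt S K n (s, T) -
  (if v0 \in T then 0 else (-1) ^+ vpos o v0 (v0 |` T)%fset *: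
     \sum_(v <- (v0 |` T)%fset) (-1) ^+ vpos o v (v0 |` T)%fset *:
        cell_elt S K n (s, (v0 |` T) `\ v)%fset).
Proof.
move=> s0; case: ifPn => v0T.
  (* When [v0] lies in [T], only the summand [v = v0] survives: every other [T \ v] still contains
     [v0] and has cone [0]. *)
  rewrite subr0 (big_fsetD1 v0) //= /cone_gen s0 !inE eqxx /= fsetD1K // scalerA.
  rewrite -expr2 sqrr_sign scale1r big_seq big1 ?addr0 // => v.
  by rewrite !inE => /andP[vv0 vT]; rewrite v0T eq_sym vv0 scaler0.
have TE : ((v0 |` T) `\ v0)%fset = T by rewrite fsetU1K.
(* The summand [v = v0] of the formal boundary cancels the cell [(s, T)]; the others match the left
   side by [sign_vpos_rem]. *)
rewrite [in RHS](big_fsetD1 v0) ?fset1U1 //= TE scalerDr scalerA -expr2 sqrr_sign scale1r.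
rewrite opprD addrA subrr add0r scaler_sumr -sumrN big_seq [RHS]big_seq.
apply: eq_bigr => v vT; have v0v : v0 != v by apply: contraNneq v0T => ->.
rewrite /cone_gen s0 !inE (negPf v0T) andbF !scalerA -!exprD -scaleNr.
have DE : ((v0 |` T) `\ v = v0 |` (T `\ v))%fset.
  by apply/fsetP => u; rewrite !inE; case: (u =P v0) => [->|]; rewrite ?v0v.
have v0U : v0 \in (v0 |` T)%fset by rewrite fset1U1.
have vU : v \in (v0 |` T)%fset by rewrite fset1Ur.
rewrite -DE -{1}TE (sign_vpos_rem o K vU v0U) 1?eq_sym // addnC.
by rewrite scaleNr.
Qed.

End CellHomology.

(** * Pushing chains into the image of the subdivision *)

Section Subdivision.
Variables (V : choiceType) (S : simplicial_complex V) (o : vertex_order V).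
Variable K : comPzRingType.
Implicit Types (s T : {fset V}) (u v w : V).
Notation D := (cell_complex S o K).
Notation h := (cone S o K).

Lemma ohead_mem (T : eqType) (r : seq T) z : ohead r = Some z -> z \in r.
Proof. by case: r => //= x r [<-]; rewrite mem_head. Qed.

Lemma ohead_fset s : s != fset0 -> exists v, ohead s = Some v.
Proof. by rewrite -cardfs_gt0; case: (enum_fset s) => // v r _; exists v. Qed.

(** For [v] other than the cone vertex, [s \ v] contains that vertex and the cone is [0]; otherwise
    the cone would be the excluded cell [(s, s)]. *)
Lemma cone_subdivision n c : h n (subdivision S o K n c) = 0.
Proof.
elim/freemod_ind: c => [|a [s sP] c IHc]; first by rewrite !linear0.
rewrite 2!linearP IHc addr0 subdivision_basis linearZ_LR.
suff -> : h n (subdivision_gen S o K n s) = 0 by rewrite !scaler0.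
rewrite linear_sum big_seq big1 // => v vs; rewrite linearZ_LR.
rewrite cone_elt; last exact: is_cell_rem_simplex sP vs.
rewrite /cone_gen; case s0: (ohead s) => [v0|]; last by rewrite scaler0.
have v0s : v0 \in s := ohead_mem s0.
rewrite !inE v0s andbT; case: eqP => [->|_] /=; last by rewrite scaler0.
by rewrite fsetD1K // cell_elt0 ?scaler0 // /is_cell /= (negPf (fproper_irrefl _)) andbF.
Qed.

(** For any vertex [v] of [s], the coefficient at the cell [(s, s \ v)] recovers that of [s] up to
    sign. *)
Lemma subdivision_inj n : injective (subdivision S o K n).
Proof.
move=> c c' cc'; apply: coefP => t; have tP := valP t.
have s0 : val t != fset0 by case/andP: tP => /set_mem tS _; exact: simplex_neq0 tS.
have [v vt] := fset0Pn _ s0; pose u := Cell (is_cell_rem_simplex tP vt).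
suff E d : (-1) ^+ (n + vpos o v (val t)) * coef (subdivision S o K n d) u = coef d t.
  by rewrite -!E cc'.
elim/freemod_ind: d => [|a t' d IHd]; first by rewrite linear0 !freemod_coef0 mulr0.
rewrite linearP !freemod_coefD !freemod_coefZ mulrDr IHd; congr (_ + _).
rewrite mulrCA; congr (_ * _); rewrite coef_basis /subdivision /= lift_basis.
rewrite freemod_coefZ freemod_coef_sum.
under eq_bigr do rewrite freemod_coefZ coef_cell_elt /= xpair_eqE.
have [tt'|tt'] := eqVneq t t'; last first.
  rewrite big1 ?mulr0 // => w _; rewrite (_ : _ && _ = false) ?mulr0 //.
  by apply: contraNF tt' => /andP[/eqP /val_inj ->].
rewrite -tt' (big_fsetD1 v) //= !eqxx mulr1 big_seq big1 ?addr0 => [|w]; last first.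
  rewrite !inE => /andP[wv ws]; rewrite (_ : (_ == _ :> {fset V}) = false) ?andbF ?mulr0 //.
  by apply/negP => /eqP/fsetP/(_ v); rewrite !inE eqxx vt eq_sym wv.
by rewrite -[X in _ * X]exprD -expr2 sqrr_sign.
Qed.

(** The exponent depends on [z], as the dimensions of the simplices in [S] need not be bounded. *)
Definition reducible n (z : D n) : Prop :=
  exists k c, iter k (@perturb K D h n) z = subdivision S o K n c.

Lemma perturb_subdivision n c :
  @perturb K D h n (subdivision S o K n c) = subdivision S o K n c.
Proof.
case: n c => [|n] c; rewrite /= cone_subdivision linear0 addr0 //.
by rewrite -bnd_subdivision cone_subdivision addr0.
Qed.

(** Further iterations fix the image of the subdivision, so both chains can be iterated [k + l]
    times. *)
Lemma reducible_lin n a (x y : D n) :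
  reducible x -> reducible y -> reducible (a *: x + y).
Proof.
have iterS k c : iter k (@perturb K D h n) (subdivision S o K n c) = subdivision S o K n c.
  by elim: k => //= k ->; exact: perturb_subdivision.
have iterL k b (z z' : D n) : iter k (@perturb K D h n) (b *: z + z') =
    b *: iter k (@perturb K D h n) z + iter k (@perturb K D h n) z'.
  by elim: k => //= k ->; rewrite perturb_linear.
move=> [k [c cE]] [l [d dE]]; exists (k + l)%N, (a *: c + d).
by rewrite iterL addnC iterD cE iterS addnC iterD dE iterS linearP.
Qed.

Lemma reducible0 n : reducible (0 : D n).
Proof. by exists 0%N, 0; rewrite linear0. Qed.

Lemma reducible_sum n (I : eqType) (r : seq I) (a : I -> K) (F : I -> D n) :
  (forall i, i \in r -> reducible (F i)) -> reducible (\sum_(i <- r) a i *: F i).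
Proof.
move=> FR; rewrite big_seq; elim/big_rec: _ => [|i x ir]; first exact: reducible0.
by apply: reducible_lin; exact: FR.
Qed.

(** By [cone_homotopy] the cells with top [s] cancel, and only tops [s \ v] remain. The exception is
    [U = s], where the cone is the excluded cell and its formal boundary, the subdivision of [s],
    stays uncancelled. *)
Lemma perturb_elt n s T v0 (U := (v0 |` T)%fset) :
    is_cell S n (s, T) -> ohead s = Some v0 ->
  @perturb K D h n (cell_elt S K n (s, T)) =
  \sum_(v <- T) (-1) ^+ vpos o v T *: cone_gen S o K n (s `\ v)%fset (T `\ v)%fset +
  (if v0 \in T then 0 else (-1) ^+ vpos o v0 U *:
     if s == U then subdivision_gen S o K n s
     else \sum_(v <- U) (-1) ^+ vpos o v U *: cell_elt S K n (s `\ v, U `\ v)%fset).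
Proof.
move=> sT s0; have -> : @perturb K D h n (cell_elt S K n (s, T)) =
    cell_elt S K n (s, T) + cell_bnd S o K n (cone_gen S o K n.+1 s T) +
    \sum_(v <- T) (-1) ^+ vpos o v T *:
      (cone_gen S o K n (s `\ v)%fset (T `\ v)%fset - cone_gen S o K n s (T `\ v)%fset).
  case: n sT => [|n] sT; rewrite /= cone_elt //.
    (* In degree 0 the set [T] is empty, so the sum standing for [hd] is empty too. *)
    have /eqP T0 : T == fset0 by case/and3P: sT => _ _; rewrite cardfs_eq0.
    by rewrite T0 big_seq_fset0 addr0.
  congr (_ + _); rewrite cell_bnd_elt // linear_sum big_seq [RHS]big_seq.
  apply: eq_bigr => v vT; rewrite linearZ linearB /= !cone_elt //.
    exact: is_cell_rem vT.
  exact: is_cell_rem2 vT.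
under eq_bigr do rewrite scalerBr; rewrite sumrB (cone_homotopy S o K n T s0).
rewrite {1}/cone_gen s0 -/U.
set X := \sum_(v <- T) _; set E := cell_elt _ _ _ _.
rewrite opprB addrCA; congr (_ + _).
rewrite [E + _]addrC -addrA [E + _]addrC subrK.
case: ifP => v0T; first by rewrite linear0 addr0.
rewrite linearZ_LR -scalerDr; congr (_ *: _).
have Us : (U `<=` s)%fset.
  rewrite fsubUset fsub1set; case/and3P: sT => _ /fproper_sub -> _; rewrite andbT.
  exact: ohead_mem s0.
have cU : #|` U| = n.+1 by rewrite cardfsU1 v0T; case/and3P: sT => _ _ /eqP ->.
case: eqP => [sU|/eqP sU].
  rewrite cell_elt0 ?linear0 ?add0r; last by rewrite /is_cell /= -sU (negPf (fproper_irrefl _)) andbF.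
  by rewrite /subdivision_gen sU.
rewrite cell_bnd_elt; last first.
  by rewrite /is_cell /= fproperEneq Us eq_sym sU cU eqxx; case/and3P: sT => ->.
rewrite /cell_bnd_gen -big_split; apply: eq_bigr => v _ /=.
by rewrite -scalerDr subrK.
Qed.

(** Induction on the number of vertices of [s]: one application of [perturb] leaves cells with
    smaller top and possibly a multiple of the subdivision of [s]. *)
Lemma reducible_elt n s T : reducible (cell_elt S K n (s, T)).
Proof.
have [N] := ubnP #|` s|; elim: N s T => // N IHN s T; rewrite ltnS => sN.
have [sT|sT] := boolP (is_cell S n (s, T)); last by rewrite cell_elt0 //; exact: reducible0.
have /and3P[/= /set_mem sS Ts /eqP cT] := sT.
have [v0 s0] := ohead_fset (simplex_neq0 sS); have v0s := ohead_mem s0.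
have IHs v T' : v \in s -> reducible (cell_elt S K n (s `\ v, T')%fset).
  by move=> vs; apply: IHN; move: sN; rewrite (cardfsD1 v) vs.
suff [k [c cE]] : reducible (@perturb K D h n (cell_elt S K n (s, T))).
  by exists k.+1, c; rewrite iterSr.
rewrite (perturb_elt sT s0) -[X in reducible (X + _)]scale1r; apply: reducible_lin.
  apply: reducible_sum => v vT; rewrite /cone_gen.
  case: ohead => [u|]; last exact: reducible0.
  case: ifP => _; first exact: reducible0.
  rewrite -[X in reducible X]addr0; apply: reducible_lin; last exact: reducible0.
  by apply: IHs; exact: (fsubsetP (fproper_sub Ts)).
case: ifP => v0T; first exact: reducible0.
rewrite -[X in reducible X]addr0; apply: reducible_lin; last exact: reducible0.
case: eqP => [sU|_].
  have sP : is_simplex S n s.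
    by rewrite /is_simplex mem_set //= sU /sdim cardfsU1 v0T cT.
  (* The scalar undoes the factor [(-1) ^+ n] in [subdivision]. *)
  exists 0%N, ((-1) ^+ n *: simp_elt K S n s).
  by rewrite linearZ_LR subdivision_simp // scalerA -expr2 sqrr_sign scale1r.
apply: reducible_sum => v; rewrite !inE => vU; apply: IHs.
by case/orP: vU => [/eqP->//|]; exact: (fsubsetP (fproper_sub Ts)).
Qed.

Lemma simplicial_homology_cell n :
  exists f : {linear simplicial_homology K S o n -> homology D n}, bijective f.
Proof.
apply: (@homology_iso K (simplicial_chains K S o) D (subdivision S o K) _ _ h) n.
- exact: bnd_subdivision.
- exact: subdivision_inj.
- exact: cone_subdivision.
move=> n; elim/freemod_ind => [|a t z]; first exact: reducible0.
by apply: reducible_lin; rewrite -cell_eltE [val t]surjective_pairing; exact: reducible_elt.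
Qed.

End Subdivision.

Theorem theorem13p13 (K : comPzRingType) (V : choiceType)
    (S : simplicial_complex V) (o : vertex_order V) (n : nat) :
  exists f : {linear simplicial_homology K S o n ->
                     homology_sc (simplex_digraph S) K n},
    bijective f.
Proof.
have [f f_bij] := simplicial_homology_cell S o K n.
have [g g_bij] := cell_homology_sc S o K n.
by exists (g \o f); exact: bij_comp.
Qed.
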